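(* Let $(\mathcal{A},\varphi,\mathcal{X},f,\Phi)$ be a non-commutative probability space of type B, let $(\mathcal{A}_1,\mathcal{X}_1)$ and $(\mathcal{A}_2,\mathcal{X}_2)$ be free independent in it, and let $(a_j,\xi_j)\in\mathcal{A}_j\times\mathcal{X}_j$, $j=1,2$, be such that $\varphi(a_j)\neq 0$. Then, as formal power series with coefficients in $\mathcal{C}$, $$S_{(a_1,\xi_1)(a_2,\xi_2)}(z)=S_{(a_1,\xi_1)}(z)\,S_{(a_2,\xi_2)}(z).$$
   Context: A non-commutative probability space of type B is a system $(\mathcal{A},\varphi,\mathcal{X},f,\Phi)$ where $\mathcal{A}$ is a complex unital algebra, $\varphi:\mathcal{A}\to\mathbb{C}$ is linear with $\varphi(1)=1$, $\mathcal{X}$ is a complex vector space, $f:\mathcal{X}\to\mathbb{C}$ is linear, and $\Phi:\mathcal{A}\times\mathcal{X}\times\mathcal{A}\to\mathcal{X}$ is a two-sided action of $\mathcal{A}$ on $\mathcal{X}$ (an $\mathcal{A}$-bimodule structure), written $a\xi b=\Phi(a,\xi,b)$. The vector space $\mathcal{A}\times\mathcal{X}$ is a unital algebra with multiplication $(a,\xi)\cdot(b,\eta)=(ab,a\eta+\xi b)$. $\mathcal{C}$ is the commutative unital algebra $\mathbb{C}\times\mathbb{C}$ (with componentwise vector space structure) with multiplication $(x,t)\cdot(y,s)=(xy,xs+ty)$ and unit $(1,0)$. Define $E:\mathcal{A}\times\mathcal{X}\to\mathcal{C}$ by $E(a,\xi)=(\varphi(a),f(\xi))$. The type B non-crossing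 cumulants are the multilinear maps $\kappa_n:(\mathcal{A}\times\mathcal{X})^n\to\mathcal{C}$, $n\ge1$, determined by $$\sum_{\gamma\in NC(n)}\ \prod_{B\in\gamma}\kappa_{|B|}\big((a_1,\xi_1),\dots,(a_n,\xi_n)\,|\,B\big)=E\big((a_1,\xi_1)\cdots(a_n,\xi_n)\big)$$ for all $n\geq 1$, $a_i\in\mathcal{A}$, $\xi_i\in\mathcal{X}$, where $NC(n)$ is the lattice of (ordinary, type A) non-crossing partitions of $\{1,\dots,n\}$, the notation $|\,B$ means keeping only the arguments with index in the block $B$, in increasing order, and the product on the left is in $\mathcal{C}$. Write $\kappa_n(a,\xi)=\kappa_n((a,\xi),\dots,(a,\xi))$. Free independence: let $\mathcal{A}_1,\dots,\mathcal{A}_k$ be unital subalgebras of $\mathcal{A}$ and $\mathcal{X}_1,\dots,\mathcal{X}_k$ linear subspaces of $\mathcal{X}$ with $\mathcal{X}_j$ invariant under the action of $\mathcal{A}_j$. Then $(\mathcal{A}_1,\mathcal{X}_1),\dots,(\mathcal{A}_k,\mathcal{X}_k)$ are free independent if $\kappa_n((a_1,\xi_1),\dots,(a_n,\xi_n))=0$ whenever $a_l\in\mathcal{A}_{i_l}$, $\xi_l\in\mathcal{X}_{i_l}$ ($l=1,\dots,n$) and there exist $1\le s<t\le n$ with $i_s\ne i_t$. The $R$-transform of $(a,\xi)$ is the formal power series $R_{(a,\xi)}(z)=\sum_{n\ge1}\kappa_n(a,\xi)z^n$ with coefficients in $\mathcal{C}$. If $\varphi(a)\ne0$, its first coefficient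 $(\varphi(a),f(\xi))$ is invertible in $\mathcal{C}$, so $R_{(a,\xi)}$ has an inverse $R_{(a,\xi)}^{\langle-1\rangle}$ under composition of formal power series, and the $S$-transform of $(a,\xi)$ is $$S_{(a,\xi)}(z)=\frac1z R_{(a,\xi)}^{\langle-1\rangle}(z).$$ *)

(* Defs.v *)
From HB Require Import structures.
From mathcomp Require Import all_boot all_order all_algebra.
From mathcomp Require Import boolp reals complex.
From mathcomp Require classical_sets.

Set Implicit Arguments.
Unset Strict Implicit.
Unset Printing Implicit Defensive.

Import GRing.Theory.

Local Open Scope ring_scope.

(* A record rather than K * K: the pair type already carries the componentwise
   ring structure, which is not the one wanted here. *)
Record dual (K : Type) := Dual { dual1 : K; dual2 : K }.

Section Dual.
Variable K : fieldType.
Local Notation C := (dual K).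
Implicit Types u v w : C.

Definition pair_of_dual u := (dual1 u, dual2 u).
Definition dual_of_pair (p : K * K) := Dual p.1 p.2.
Lemma pair_of_dualK : cancel pair_of_dual dual_of_pair.
Proof. by case. Qed.
HB.instance Definition _ := Choice.copy C (can_type pair_of_dualK).

Lemma dualP u v : dual1 u = dual1 v -> dual2 u = dual2 v -> u = v.
Proof. by case: u v => x t [y s] /= -> ->. Qed.

Definition dual_zero : C := Dual 0 0.
Definition dual_opp u : C := Dual (- dual1 u) (- dual2 u).
Definition dual_add u v : C := Dual (dual1 u + dual1 v) (dual2 u + dual2 v).
Fact dual_addA : associative dual_add.
Proof. by move=> u v w; apply: dualP; rewrite /= addrA. Qed.
Fact dual_addC : commutative dual_add.
Proof. by move=> u v; apply: dualP; rewrite /= addrC. Qed.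
Fact dual_add0 : left_id dual_zero dual_add.
Proof. by move=> u; apply: dualP; rewrite /= add0r. Qed.
Fact dual_addN : left_inverse dual_zero dual_opp dual_add.
Proof. by move=> u; apply: dualP; rewrite /= addNr. Qed.
HB.instance Definition _ :=
  GRing.isZmodule.Build C dual_addA dual_addC dual_add0 dual_addN.

Definition dual_one : C := Dual 1 0.
Definition dual_mul u v : C :=
  Dual (dual1 u * dual1 v) (dual1 u * dual2 v + dual2 u * dual1 v).
Fact dual_mulA : associative dual_mul.
Proof.
by move=> u v w; apply: dualP; rewrite /= ?mulrDr ?mulrDl !mulrA ?addrA.
Qed.
Fact dual_mulC : commutative dual_mul.
Proof.
move=> u v; apply: dualP; rewrite /= ?(mulrC (dual1 v)) //.
by rewrite addrC (mulrC (dual2 v)).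
Qed.
Fact dual_mul1 : left_id dual_one dual_mul.
Proof. by move=> u; apply: dualP; rewrite /= ?mul0r ?addr0 mul1r. Qed.
Fact dual_mulDl : left_distributive dual_mul dual_add.
Proof.
by move=> u v w; apply: dualP; rewrite /= !mulrDl // addrACA.
Qed.
Fact dual_one_neq0 : dual_one != dual_zero.
Proof. by apply/eqP => -[] /eqP; rewrite oner_eq0. Qed.
HB.instance Definition _ := GRing.Zmodule_isComNzRing.Build C
  dual_mulA dual_mulC dual_mul1 dual_mulDl dual_one_neq0.

Definition dual_scale (c : K) u : C := Dual (c * dual1 u) (c * dual2 u).
Fact dual_scaleA a b u : dual_scale a (dual_scale b u) = dual_scale (a * b) u.
Proof. by apply: dualP; rewrite /= mulrA. Qed.
Fact dual_scale1 : left_id 1 dual_scale.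
Proof. by move=> u; apply: dualP; rewrite /= mul1r. Qed.
Fact dual_scaleDr : right_distributive dual_scale +%R.
Proof. by move=> a u v; apply: dualP; rewrite /= mulrDr. Qed.
Fact dual_scaleDl u : {morph dual_scale^~ u : a b / a + b}.
Proof. by move=> a b; apply: dualP; rewrite /= mulrDl. Qed.
HB.instance Definition _ := GRing.Zmodule_isLmodule.Build K C
  dual_scaleA dual_scale1 dual_scaleDr dual_scaleDl.
Fact dual_scaleAl (a : K) u v : a *: (u * v) = (a *: u) * v.
Proof. by apply: dualP; rewrite /= ?mulrDr !mulrA. Qed.
HB.instance Definition _ := GRing.Lmodule_isLalgebra.Build K C dual_scaleAl.
HB.instance Definition _ := GRing.Lalgebra_isComAlgebra.Build K C.

Definition dual_unit : {pred C} := [pred u | dual1 u != 0].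
Definition dual_inv u : C :=
  if u \in dual_unit then Dual (dual1 u)^-1 (- dual2 u / dual1 u ^+ 2) else u.
Fact dual_mulV : {in dual_unit, left_inverse 1 dual_inv *%R}.
Proof.
move=> u uU; rewrite /dual_inv uU; move: uU; rewrite inE => u0.
apply: dualP; rewrite /= ?mulVf // expr2 invfM -!mulrA mulVf // mulr1.
by rewrite mulNr [_^-1 * _]mulrC subrr.
Qed.
Fact dual_unitP u v : v * u = 1 -> u \in dual_unit.
Proof.
case=> vu _; rewrite inE; apply: contra_eqN vu => /eqP ->.
by rewrite mulr0 eq_sym oner_eq0.
Qed.
Fact dual_inv_out : {in [predC dual_unit], dual_inv =1 id}.
Proof. by move=> u; rewrite /dual_inv inE /= => /negbTE ->. Qed.
HB.instance Definition _ := GRing.ComNzRing_hasMulInverse.Build C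
  dual_mulV dual_unitP dual_inv_out.

Lemma dual_unitE u : (u \is a GRing.unit) = (dual1 u != 0).
Proof. by []. Qed.

End Dual.

(* ncact a xi b is the two-sided product a xi b; trilinearity with ncact1 and
   ncactM says that xi |-> ncact a xi 1 and xi |-> ncact 1 xi b are commuting
   unital left and right actions, i.e. that ncX is a bimodule over ncA. *)
Record ncps_typeB (K : fieldType) := NcpsTypeB {
  ncA : algType K;
  ncphi : {scalar ncA};
  ncX : lmodType K;
  ncf : {scalar ncX};
  ncact : ncA -> ncX -> ncA -> ncX;
  ncphi1 : ncphi 1 = 1;
  ncact_linear1 : forall xi b, linear (fun a => ncact a xi b);
  ncact_linear2 : forall a b, linear (fun xi => ncact a xi b);
  ncact_linear3 : forall a xi, linear (fun b => ncact a xi b);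
  ncact1 : forall xi, ncact 1 xi 1 = xi;
  ncactM : forall a b xi c d,
    ncact (a * b) xi (c * d) = ncact a (ncact b xi c) d
}.

Record prodAX (K : fieldType) (P : ncps_typeB K) :=
  ProdAX { fstA : ncA P; sndX : ncX P }.

Section ProdAX.
Variables (K : fieldType) (P : ncps_typeB K).
Local Notation AX := (prodAX P).
Implicit Types x y z : AX.

Definition pair_of_prodAX x := (fstA x, sndX x).
Definition prodAX_of_pair (p : ncA P * ncX P) : AX := ProdAX p.1 p.2.
Lemma pair_of_prodAXK : cancel pair_of_prodAX prodAX_of_pair.
Proof. by case. Qed.
HB.instance Definition _ := Choice.copy AX (can_type pair_of_prodAXK).

Lemma prodAXP x y : fstA x = fstA y -> sndX x = sndX y -> x = y.
Proof. by case: x y => a xi [b eta] /= -> ->. Qed.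

Definition prodAX_zero : AX := ProdAX 0 0.
Definition prodAX_opp x : AX := ProdAX (- fstA x) (- sndX x).
Definition prodAX_add x y : AX := ProdAX (fstA x + fstA y) (sndX x + sndX y).
Fact prodAX_addA : associative prodAX_add.
Proof. by move=> x y z; apply: prodAXP; rewrite /= addrA. Qed.
Fact prodAX_addC : commutative prodAX_add.
Proof. by move=> x y; apply: prodAXP; rewrite /= addrC. Qed.
Fact prodAX_add0 : left_id prodAX_zero prodAX_add.
Proof. by move=> x; apply: prodAXP; rewrite /= add0r. Qed.
Fact prodAX_addN : left_inverse prodAX_zero prodAX_opp prodAX_add.
Proof. by move=> x; apply: prodAXP; rewrite /= addNr. Qed.
HB.instance Definition _ :=
  GRing.isZmodule.Build AX prodAX_addA prodAX_addC prodAX_add0 prodAX_addN.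

Definition prodAX_scale (c : K) x : AX := ProdAX (c *: fstA x) (c *: sndX x).
Fact prodAX_scaleA a b x :
  prodAX_scale a (prodAX_scale b x) = prodAX_scale (a * b) x.
Proof. by apply: prodAXP; rewrite /= scalerA. Qed.
Fact prodAX_scale1 : left_id 1 prodAX_scale.
Proof. by move=> x; apply: prodAXP; rewrite /= scale1r. Qed.
Fact prodAX_scaleDr : right_distributive prodAX_scale +%R.
Proof. by move=> a x y; apply: prodAXP; rewrite /= scalerDr. Qed.
Fact prodAX_scaleDl x : {morph prodAX_scale^~ x : a b / a + b}.
Proof. by move=> a b; apply: prodAXP; rewrite /= scalerDl. Qed.
HB.instance Definition _ := GRing.Zmodule_isLmodule.Build K AX
  prodAX_scaleA prodAX_scale1 prodAX_scaleDr prodAX_scaleDl.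

Lemma ncactDl a b (xi : ncX P) c : ncact (a + b) xi c = ncact a xi c + ncact b xi c.
Proof. by have := ncact_linear1 xi c 1 a b; rewrite !scale1r. Qed.
Lemma ncactDm a (xi eta : ncX P) b :
  ncact a (xi + eta) b = ncact a xi b + ncact a eta b.
Proof. by have := ncact_linear2 a b 1 xi eta; rewrite !scale1r. Qed.
Lemma ncactDr a (xi : ncX P) b c : ncact a xi (b + c) = ncact a xi b + ncact a xi c.
Proof. by have := ncact_linear3 a xi 1 b c; rewrite !scale1r. Qed.
Lemma ncact0l (xi : ncX P) b : ncact 0 xi b = 0.
Proof. by apply: (addIr (ncact 0 xi b)); rewrite -ncactDl !add0r. Qed.
Lemma ncact0m a b : ncact a (0 : ncX P) b = 0.
Proof. by apply: (addIr (ncact a 0 b)); rewrite -ncactDm !add0r. Qed.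
Lemma ncact0r a (xi : ncX P) : ncact a xi 0 = 0.
Proof. by apply: (addIr (ncact a xi 0)); rewrite -ncactDr !add0r. Qed.
Lemma ncactZl k a (xi : ncX P) b : ncact (k *: a) xi b = k *: ncact a xi b.
Proof. by have := ncact_linear1 xi b k a 0; rewrite !addr0 ncact0l addr0. Qed.
Lemma ncactZm k a (xi : ncX P) b : ncact a (k *: xi) b = k *: ncact a xi b.
Proof. by have := ncact_linear2 a b k xi 0; rewrite !addr0 ncact0m addr0. Qed.
Lemma ncactZr k a (xi : ncX P) b : ncact a xi (k *: b) = k *: ncact a xi b.
Proof. by have := ncact_linear3 a xi k b 0; rewrite !addr0 ncact0r addr0. Qed.

(* One-sided actions: a xi = ncact a xi 1 and xi b = ncact 1 xi b. *)
Definition prodAX_one : AX := ProdAX 1 0.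
Definition prodAX_mul x y : AX :=
  ProdAX (fstA x * fstA y)
         (ncact (fstA x) (sndX y) 1 + ncact 1 (sndX x) (fstA y)).
Fact prodAX_mulA : associative prodAX_mul.
Proof.
move=> x y z; apply: prodAXP; rewrite /= ?mulrA //.
by rewrite !ncactDm -!ncactM !mul1r !mulr1 addrA.
Qed.
Fact prodAX_mul1l : left_id prodAX_one prodAX_mul.
Proof.
by move=> x; apply: prodAXP; rewrite /= ?mul1r // ncact1 ncact0m addr0.
Qed.
Fact prodAX_mul1r : right_id prodAX_one prodAX_mul.
Proof.
by move=> x; apply: prodAXP; rewrite /= ?mulr1 // ncact1 ncact0m add0r.
Qed.
Fact prodAX_mulDl : left_distributive prodAX_mul prodAX_add.
Proof.
move=> x y z; apply: prodAXP; rewrite /= ?mulrDl //.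
by rewrite ncactDl ncactDm addrACA.
Qed.
Fact prodAX_mulDr : right_distributive prodAX_mul prodAX_add.
Proof.
move=> x y z; apply: prodAXP; rewrite /= ?mulrDr //.
by rewrite ncactDr ncactDm addrACA.
Qed.
Fact prodAX_one_neq0 : prodAX_one != prodAX_zero.
Proof. by apply/eqP => -[] /eqP; rewrite oner_eq0. Qed.
HB.instance Definition _ := GRing.Zmodule_isNzRing.Build AX prodAX_mulA
  prodAX_mul1l prodAX_mul1r prodAX_mulDl prodAX_mulDr prodAX_one_neq0.
Fact prodAX_scaleAl (k : K) x y : k *: (x * y) = (k *: x) * y.
Proof.
apply: prodAXP; rewrite /= ?scalerAl // scalerDr.
by rewrite ncactZl ncactZm.
Qed.
HB.instance Definition _ := GRing.Lmodule_isLalgebra.Build K AX prodAX_scaleAl.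
Fact prodAX_scaleAr (k : K) x y : k *: (x * y) = x * (k *: y).
Proof.
apply: prodAXP; rewrite /= ?scalerAr // scalerDr.
by rewrite ncactZr ncactZm.
Qed.
HB.instance Definition _ := GRing.Lalgebra_isAlgebra.Build K AX prodAX_scaleAr.

Definition expectB x : dual K := Dual (ncphi P (fstA x)) (ncf P (sndX x)).

Lemma expectB_linear : linear expectB.
Proof. by move=> k x y; apply: dualP; rewrite /= linearP. Qed.

End ProdAX.

Definition noncrossing n (g : {set {set 'I_n}}) : bool :=
  partition g [set: 'I_n] &&
  [forall B1 in g, forall B2 in g, (B1 != B2) ==>
    ~~ [exists i in B1, exists j in B2, exists k in B1, exists l in B2,
          [&& (i < j)%N, (j < k)%N & (k < l)%N]]].

Section Noncrossing.
Variable n : nat.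
Implicit Types (g : {set {set 'I_n}}) (B : {set 'I_n}).

Lemma noncrossing1 : (0 < n)%N -> noncrossing [set [set: 'I_n]].
Proof.
move=> n0; apply/andP; split.
  rewrite /partition /cover big_set1 eqxx /= trivIset1 inE eq_sym.
  by apply/set0Pn; exists (Ordinal n0).
apply/'forall_implyP => B1; rewrite inE => /eqP ->.
by apply/'forall_implyP => B2; rewrite inE => /eqP ->; rewrite eqxx.
Qed.

Lemma noncrossing_card_lt g B : noncrossing g -> g != [set [set: 'I_n]] ->
  B \in g -> (#|B| < n)%N.
Proof.
case/andP => /and3P[/eqP cg tg g0] _ gN Bg.
rewrite -[X in (_ < X)%N]card_ord -cardsT proper_card //.
rewrite properT; apply: contra gN => /eqP BT; subst B.
rewrite eqEsubset [X in _ && X]sub1set Bg andbT; apply/subsetP => B' B'g.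
rewrite inE; apply: contraNT g0 => B'T.
have /trivIsetP/(_ _ _ B'g Bg B'T) := tg.
by rewrite -setI_eq0 setIT => /eqP <-.
Qed.

End Noncrossing.

Section Cumulants.
Variables (K : fieldType) (P : ncps_typeB K).
Local Notation AX := (prodAX P).

(* The moment-cumulant formula solved for the term of the one-block partition.
   The fuel m is needed because the size of a proper block is not structurally
   smaller than n.  enum_val lists a block of 'I_n in increasing order. *)
Fixpoint kappa_rec (m n : nat) (x : 'I_n -> AX) : dual K :=
  if m is m'.+1 then
    expectB (\prod_(i < n) x i) -
    \sum_(g : {set {set 'I_n}} | noncrossing g && (g != [set [set: 'I_n]]))
      \prod_(B in g) kappa_rec m' (fun j : 'I_#|B| => x (enum_val j))
  else 0.

Definition kappa (n : nat) (x : 'I_n -> AX) : dual K := kappa_rec n x.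

Lemma kappa_rec_fuel m m' n (x : 'I_n -> AX) : (0 < n)%N ->
  (n <= m)%N -> (n <= m')%N -> kappa_rec m x = kappa_rec m' x.
Proof.
elim: m m' n x => [|m IH] [|m'] n x n0 nm nm' //=.
- by move: (leq_trans n0 nm).
- by move: (leq_trans n0 nm').
congr (_ - _); apply: eq_bigr => g /andP[gNC gN].
apply: eq_bigr => B Bg; have Bn := noncrossing_card_lt gNC gN Bg.
apply: IH; last 2 first.
- by rewrite -ltnS (leq_trans Bn).
- by rewrite -ltnS (leq_trans Bn).
rewrite card_gt0; apply: contraTneq Bg => ->.
by case/andP: gNC => /and3P[].
Qed.

Lemma kappa_cast (k : forall n, ('I_n -> AX) -> dual K) n n' (e : n' = n)
  (x : 'I_n -> AX) : k n' (fun j => x (cast_ord e j)) = k n x.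
Proof.
by subst n'; congr (k n _); apply: funext => j; rewrite cast_ord_id.
Qed.

Lemma enum_val_setT n (e : #|[set: 'I_n]| = n) (j : 'I_#|[set: 'I_n]|) :
  enum_val j = cast_ord e j.
Proof.
apply: val_inj => /=; rewrite /enum_val enum_setT -enumT.
by rewrite nth_enum_ord // -[X in (_ < X)%N]e.
Qed.

Lemma prod_setT (k : forall n, ('I_n -> AX) -> dual K) n (x : 'I_n -> AX) :
  \prod_(B in [set [set: 'I_n]]) k #|B| (fun j => x (enum_val j)) = k n x.
Proof.
have e : #|[set: 'I_n]| = n by rewrite cardsT card_ord.
rewrite big_set1 -(kappa_cast k e); congr (k _ _).
by apply: funext => j; rewrite (enum_val_setT e).
Qed.

Theorem moment_cumulant n (x : 'I_n -> AX) : (0 < n)%N ->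
  \sum_(g : {set {set 'I_n}} | noncrossing g)
     \prod_(B in g) kappa (fun j : 'I_#|B| => x (enum_val j))
  = expectB (\prod_(i < n) x i).
Proof.
move=> n0; rewrite (bigD1 _ (noncrossing1 n0)) /= prod_setT.
rewrite /kappa; case: n n0 x => // n n0 x /=.
rewrite -addrA -[RHS]addr0; congr (_ + _); rewrite addrC.
apply/eqP; rewrite subr_eq0; apply/eqP.
apply: eq_bigr => g /andP[gNC gN].
apply: eq_bigr => B Bg; have Bn := noncrossing_card_lt gNC gN Bg.
apply: kappa_rec_fuel => //.
rewrite card_gt0; apply: contraTneq Bg => ->.
by case/andP: gNC => /and3P[].
Qed.

Theorem kappa_unique (k : forall n, ('I_n -> AX) -> dual K) :
  (forall n (x : 'I_n -> AX), (0 < n)%N ->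
    \sum_(g : {set {set 'I_n}} | noncrossing g)
       \prod_(B in g) k #|B| (fun j => x (enum_val j))
    = expectB (\prod_(i < n) x i)) ->
  forall n (x : 'I_n -> AX), (0 < n)%N -> k n x = kappa x.
Proof.
move=> kP n; have [m] := ubnP n; elim: m n => // m IH n; rewrite ltnS => nm.
move=> x n0; have := kP n x n0; rewrite -moment_cumulant //.
rewrite !(bigD1 _ (noncrossing1 n0)) /=.
rewrite (prod_setT k) (prod_setT (@kappa)).
have -> : \sum_(g : {set {set 'I_n}} | noncrossing g && (g != [set setT]))
     \prod_(B in g) k #|B| (fun j => x (enum_val j))
   = \sum_(g : {set {set 'I_n}} | noncrossing g && (g != [set setT]))
     \prod_(B in g) kappa (fun j : 'I_#|B| => x (enum_val j)).
  apply: eq_bigr => g /andP[gNC gN]; apply: eq_bigr => B Bg.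
  apply: IH; first by rewrite (leq_trans (noncrossing_card_lt gNC gN Bg)).
  rewrite card_gt0; apply: contraTneq Bg => ->.
  by case/andP: gNC => /and3P[].
exact: addIr.
Qed.

Lemma prod_linear n (i : 'I_n) (c : K) (x y z : 'I_n -> AX) :
  (forall j, j != i -> x j = z j /\ y j = z j) -> z i = c *: x i + y i ->
  \prod_(j < n) z j = c *: \prod_(j < n) x j + \prod_(j < n) y j.
Proof.
elim: n i x y z => [[] //|n IH] i x y z xyz zi; rewrite !big_ord_recl.
have [i0|i0] := eqVneq i ord0.
  rewrite -i0 zi mulrDl -scalerAl; congr (_ *: (_ * _) + _ * _).
    by apply: eq_bigr => j _; rewrite (xyz _ _).1 // i0 -val_eqE.
  by apply: eq_bigr => j _; rewrite (xyz _ _).2 // i0 -val_eqE.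
case: (unliftP ord0 i) zi xyz => [i' ->|e]; last by rewrite e eqxx in i0.
move=> zi xyz.
rewrite (IH i' (fun j => x (lift ord0 j)) (fun j => y (lift ord0 j))) //.
  by rewrite mulrDr -scalerAr (xyz _ _).1 // (xyz ord0 _).2.
by move=> j ji; apply: xyz; rewrite (inj_eq lift_inj).
Qed.

Theorem kappa_multilinear n (i : 'I_n) (c : K) (x y z : 'I_n -> AX) :
  (forall j, j != i -> x j = z j /\ y j = z j) -> z i = c *: x i + y i ->
  kappa z = c *: kappa x + kappa y.
Proof.
move=> xyz zi; rewrite /kappa; move: {1 3 5}n => m.
elim: m n i x y z xyz zi => [|m IH] n i x y z xyz zi /=.
  by rewrite scaler0 addr0.
rewrite (prod_linear xyz zi) expectB_linear scalerBr addrACA -opprD.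
congr (_ - _); rewrite scaler_sumr -big_split /=.
apply: eq_bigr => g /andP[/andP[/and3P[/eqP cg tg _] _] _].
have ig : i \in cover g by rewrite cg inE.
pose B0 := pblock g i.
have Bg : B0 \in g by rewrite pblock_mem.
have iB : i \in B0 by rewrite mem_pblock.
have ext (w : 'I_n -> AX) : (forall j, j != i -> w j = z j) ->
  \prod_(B in g | B != B0) kappa_rec m (fun j : 'I_#|B| => w (enum_val j))
  = \prod_(B in g | B != B0) kappa_rec m (fun j : 'I_#|B| => z (enum_val j)).
  move=> wz; apply: eq_bigr => B /andP[B1 BB]; congr (kappa_rec m _).
  apply: funext => j; apply: wz; apply: contra BB => /eqP ji.
  by rewrite /B0 (def_pblock tg B1) // -ji enum_valP.
rewrite (bigD1 B0) //= [X in _ *: X](bigD1 B0) //= [X in _ = _ + X](bigD1 B0) //=.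
rewrite (ext x) ?(ext y); last 2 first.
- by move=> j /xyz[].
- by move=> j /xyz[].
rewrite scalerAl -mulrDl; congr (_ * _).
apply: (IH _ (enum_rank_in iB i)); rewrite ?enum_rankK_in //.
move=> j ji; apply: xyz; apply: contra ji => /eqP e.
by apply/eqP/enum_val_inj; rewrite e enum_rankK_in.
Qed.

End Cumulants.

(* F n is the coefficient of z^n. *)
Definition fps (A : Type) := nat -> A.

Section Fps.
Variable A : comUnitRingType.
Implicit Types (F G H : fps A) (p q : {poly A}).

Definition fps_one : fps A := fun n => (n == 0%N)%:R.
Definition fps_X : fps A := fun n => (n == 1%N)%:R.
Definition fps_mul F G : fps A :=
  fun n => \sum_(i < n.+1) F i * G (n - i)%N.
Definition fps_exp F k : fps A := iter k (fps_mul F) fps_one.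

(* F(G(z)); meaningful when G 0 = 0, in which case the coefficient of z^n in
   G^k vanishes for k > n. *)
Definition fps_comp F G : fps A :=
  fun n => \sum_(k < n.+1) F k * fps_exp G k n.

Definition is_comp_inv F G : Prop :=
  [/\ G 0%N = 0, fps_comp F G = fps_X & fps_comp G F = fps_X].

Definition comp_inv F : fps A :=
  classical_sets.xget (fun=> 0) (is_comp_inv F : classical_sets.set (fps A)).

(* Series are compared with their truncations, which are polynomials. *)
Definition fps_trunc m F : {poly A} := \poly_(i < m) F i.

Definition cong_upto m (p q : {poly A}) := forall i, (i < m)%N -> p`_i = q`_i.

Lemma cong_upto_mul m p (p' : {poly A}) q (q' : {poly A}) :
  cong_upto m p p' -> cong_upto m q q' -> cong_upto m (p * q) (p' * q').
Proof.
move=> pp qq i im; rewrite !coefM; apply: eq_bigr => j _.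
by rewrite pp ?qq // (leq_ltn_trans _ im) ?leq_subr // -ltnS.
Qed.

Lemma cong_upto_exp m p (p' : {poly A}) k :
  cong_upto m p p' -> cong_upto m (p ^+ k) (p' ^+ k).
Proof.
move=> pp; elim: k => [|k IH]; first by rewrite !expr0.
by rewrite !exprS; apply: cong_upto_mul.
Qed.

Lemma cong_upto_mulS m p (p' : {poly A}) q (q' : {poly A}) :
  p`_0 = 0 -> p'`_0 = 0 -> q`_0 = 0 -> q'`_0 = 0 ->
  cong_upto m p p' -> cong_upto m q q' -> cong_upto m.+1 (p * q) (p' * q').
Proof.
move=> p0 p'0 q0 q'0 pp qq i im; rewrite !coefM; apply: eq_bigr => -[j ji] _ /=.
case: j ji => [|j] ji; first by rewrite p0 p'0 !mul0r.
have [ij|ij] := leqP i j.+1.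
  by have /eqP -> : (i - j.+1 == 0)%N by []; rewrite q0 q'0 !mulr0.
have im' : (i <= m)%N by [].
rewrite pp ?qq ?(leq_trans ij) // (leq_trans _ im') //.
by rewrite ltn_subrL (leq_ltn_trans _ ij).
Qed.

Lemma coef_exp_gt (p : {poly A}) k i : p`_0 = 0 -> (i < k)%N -> (p ^+ k)`_i = 0.
Proof.
move=> p0; elim: k i => // k IH i ik.
rewrite exprS coefM big1 // => -[[|j] ji] _; first by rewrite p0 mul0r.
rewrite /= IH ?mulr0 //; case: i ik ji => [|i] // ik _.
by rewrite subSS (leq_ltn_trans (leq_subr _ _)).
Qed.

Lemma coef_trunc m F i : (i < m)%N -> (fps_trunc m F)`_i = F i.
Proof. by rewrite coef_poly => ->. Qed.

Lemma fps_exp_trunc m F k n : (n < m)%N ->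
  fps_exp F k n = (fps_trunc m F ^+ k)`_n.
Proof.
elim: k n => [|k IH] n nm; first by rewrite expr0 coef1.
rewrite exprS coefM /= /fps_mul; apply: eq_bigr => j _.
rewrite coef_trunc ?(leq_trans (ltn_ord j)) // IH //.
by rewrite (leq_ltn_trans (leq_subr _ _)).
Qed.

Lemma coef_comp0 (p q : {poly A}) m i : q`_0 = 0 -> (i < m)%N ->
  (p \Po q)`_i = \sum_(k < m) p`_k * (q ^+ k)`_i.
Proof.
move=> q0 im; rewrite comp_polyE coef_sum; under eq_bigr do rewrite coefZ.
pose f k := p`_k * (q ^+ k)`_i.
rewrite -!(big_mkord xpredT f).
pose N := (m + size p)%N.
rewrite -[LHS]addr0 -[RHS]addr0.
rewrite [X in _ + X = _](_ : 0 = \sum_(size p <= k < N) f k); last first.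
  rewrite big_nat_cond big1 // => k /andP[/andP[pk _] _].
  by rewrite /f nth_default // mul0r.
rewrite [X in _ = _ + X](_ : 0 = \sum_(m <= k < N) f k); last first.
  rewrite big_nat_cond big1 // => k /andP[/andP[mk _] _].
  by rewrite /f coef_exp_gt ?mulr0 // (leq_trans im).
by rewrite -!big_cat_nat ?leq_addl ?leq_addr.
Qed.

Lemma fps_comp_trunc m F G n : G 0%N = 0 -> (n < m)%N ->
  fps_comp F G n = (fps_trunc m F \Po fps_trunc m G)`_n.
Proof.
move=> G0 nm; have m0 : (0 < m)%N by case: m nm.
rewrite (coef_comp0 _ _ (ltnSn n)) ?coef_trunc //.
apply: eq_bigr => k _; rewrite coef_trunc ?(leq_trans (ltn_ord k)) //.
by rewrite (fps_exp_trunc _ _ nm).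
Qed.

Lemma cong_upto_comp m p (p' : {poly A}) q (q' : {poly A}) : q`_0 = 0 -> q'`_0 = 0 ->
  cong_upto m p p' -> cong_upto m q q' -> cong_upto m (p \Po q) (p' \Po q').
Proof.
move=> q0 q'0 pp qq i im; rewrite !(coef_comp0 _ _ im) //.
by apply: eq_bigr => k _; rewrite pp // (cong_upto_exp k qq).
Qed.

Lemma fps_comp0 F G : F 0%N = 0 -> fps_comp F G 0%N = 0.
Proof. by move=> F0; rewrite /fps_comp big_ord1 F0 mul0r. Qed.

Lemma fps_compA F G H : G 0%N = 0 -> H 0%N = 0 ->
  fps_comp (fps_comp F G) H = fps_comp F (fps_comp G H).
Proof.
move=> G0 H0; apply: funext => n; have nn := ltnSn n.
have GH0 := fps_comp0 H G0.
rewrite !(fps_comp_trunc _ _ nn) //.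
have cong_comp F' G' : G' 0%N = 0 -> cong_upto n.+1
    (fps_trunc n.+1 (fps_comp F' G')) (fps_trunc n.+1 F' \Po fps_trunc n.+1 G').
  by move=> G'0 i im; rewrite coef_trunc // (fps_comp_trunc _ _ im).
have TH0 : (fps_trunc n.+1 H)`_0 = 0 by rewrite coef_trunc.
rewrite (cong_upto_comp TH0 TH0 (cong_comp _ _ G0) (fun _ _ => erefl)) //.
rewrite -comp_polyA; apply: esym; apply: (@cong_upto_comp n.+1) => //.
- by rewrite coef_trunc.
- by rewrite -(cong_comp G H H0) // coef_trunc.
- exact: cong_comp.
Qed.

Lemma fps_expX k n : fps_exp fps_X k n = (n == k)%:R.
Proof.
rewrite (fps_exp_trunc _ _ (leq_addr 2 n.+1)).
suff -> : fps_trunc (n.+1 + 2) fps_X = 'X by rewrite coefXn.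
apply/polyP => i; rewrite coef_poly coefX /fps_X; case: ifPn => //.
by case: i => [|[|i]] //; rewrite addnS ltnS addnS.
Qed.

Lemma fps_compX F : fps_comp F fps_X = F.
Proof.
apply: funext => n; rewrite /fps_comp big_ord_recr /= fps_expX eqxx mulr1.
rewrite big1 ?add0r // => k _; rewrite fps_expX.
by rewrite gtn_eqF ?mulr0.
Qed.

Lemma fps_Xcomp F : F 0%N = 0 -> fps_comp fps_X F = F.
Proof.
move=> F0; apply: funext => n; have nm : (n < n.+2)%N by [].
rewrite (fps_comp_trunc _ _ nm) //.
suff -> : fps_trunc n.+2 fps_X = 'X by rewrite comp_polyX coef_trunc.
by apply/polyP => -[|[|i]]; rewrite coef_poly coefX //= /fps_X; case: ifP.
Qed.

Lemma fps_rinv F : F 0%N = 0 -> F 1%N \is a GRing.unit ->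
  exists2 G : fps A, G 0%N = 0 & fps_comp F G = fps_X.
Proof.
move=> F0 F1.
pose c n (q : {poly A}) :=
  (F 1%N)^-1 * (fps_X n.+1 - (fps_trunc n.+2 F \Po q)`_n.+1).
pose fix p n : {poly A} :=
  if n is n'.+1 then p n' + c n' (p n') *: 'X^(n'.+1) else 0.
have pS n : p n.+1 = p n + c n (p n) *: 'X^(n.+1) by [].
have pz : p 0%N = 0 by [].
clearbody p.
have p0 n : (p n)`_0 = 0.
  elim: n => [|n IH]; first by rewrite pz coef0.
  by rewrite pS coefD IH coefZ coefXn mulr0 addr0.
have pgt n i : (n < i)%N -> (p n)`_i = 0.
  elim: n => [|n IH] ni; first by rewrite pz coef0.
  by rewrite pS coefD IH ?(ltnW ni) // coefZ coefXn gtn_eqF // mulr0 addr0.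
have ple n i : (i <= n)%N -> (p n)`_i = (p i)`_i.
  elim: n => [|n IH]; first by rewrite leqn0 => /eqP ->.
  rewrite leq_eqVlt => /predU1P[-> //|] ni.
  by rewrite pS coefD coefZ coefXn ltn_eqF // mulr0 addr0 IH.
pose G : fps A := fun n => (p n)`_n.
have G0 : G 0%N = 0 by rewrite /G p0.
exists G => //; apply: funext => -[|n]; first by rewrite fps_comp0.
have nm : (n.+1 < n.+2)%N by [].
rewrite (fps_comp_trunc _ _ nm) //.
have TG0 : (fps_trunc n.+2 G)`_0 = 0 by rewrite coef_trunc.
have congG : cong_upto n.+2 (fps_trunc n.+2 G) (p n.+1).
  by move=> i im; rewrite coef_trunc // /G ple.
rewrite (cong_upto_comp TG0 (p0 n.+1) (fun _ _ => erefl) congG) //.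
set T := fps_trunc n.+2 F; set q := p n.
have TE : (T \Po p n.+1)`_n.+1 = F 1%N * c n q + (T \Po q)`_n.+1.
  rewrite !(coef_comp0 _ _ nm) ?p0 // !big_ord_recl /=.
  rewrite !expr0 !expr1 coef1 /= !mulr0 !add0r !coef_trunc //.
  rewrite [in LHS]pS -/q coefD coefZ coefXn eqxx mulr1 {1 3}/q pgt // add0r mulr0 add0r.
  congr (_ + _); apply: eq_bigr => k _; congr (_ * _).
  rewrite -pS !exprS.
  have pq : cong_upto n.+1 (p n.+1) q.
    by move=> i im; rewrite (ple n.+1) ?(ltnW im) // (ple n).
  suff e : cong_upto n.+2 (p n.+1 * (p n.+1 * p n.+1 ^+ k)) (q * (q * q ^+ k)).
    exact: e.
  apply: cong_upto_mulS => //; rewrite ?p0 // ?coefM ?big_ord1 ?p0 ?mul0r //.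
  by apply: cong_upto_mul => //; apply: cong_upto_exp.
by rewrite TE /c -/T mulVKr // subrK.
Qed.

Theorem comp_invP F : F 0%N = 0 -> F 1%N \is a GRing.unit ->
  is_comp_inv F (comp_inv F).
Proof.
move=> F0 F1; have [G G0 FG] := fps_rinv F0 F1.
have G1 : G 1%N \is a GRing.unit.
  have := congr1 (fun H : fps A => H 1%N) FG.
  rewrite /fps_comp !big_ord_recl big_ord0 F0 mul0r add0r addr0.
  rewrite (fps_exp_trunc _ _ (ltnSn 1)) /= expr1 coef_trunc // => FG1.
  by apply/unitrPr; exists (F 1%N); rewrite mulrC.
have [H H0 GH] := fps_rinv G0 G1.
have FH : F = H by rewrite -[F]fps_compX -GH -fps_compA // FG fps_Xcomp.
apply: classical_sets.xgetPex; exists G.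
by split=> //; rewrite FH.
Qed.

Theorem comp_inv_unique F G G' :
  F 0%N = 0 -> is_comp_inv F G -> is_comp_inv F G' -> G = G'.
Proof.
move=> F0 [G0 FG GF] [G'0 FG' G'F].
by rewrite -[G]fps_compX -FG' -fps_compA // GF fps_Xcomp.
Qed.

End Fps.

Section Transforms.
Variables (K : fieldType) (P : ncps_typeB K).

Definition typeB_subspace (A' : {pred ncA P}) (X' : {pred ncX P}) : Prop :=
  [/\ GRing.subalg_closed A', GRing.submod_closed X' &
      {in A' & A', forall a b, {in X', forall xi, ncact a xi b \in X'}}].

Definition free_independent k
    (As : 'I_k -> {pred ncA P}) (Xs : 'I_k -> {pred ncX P}) : Prop :=
  (forall j, typeB_subspace (As j) (Xs j)) /\
  forall n (i : 'I_n -> 'I_k) (x : 'I_n -> prodAX P),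
    (forall l, fstA (x l) \in As (i l) /\ sndX (x l) \in Xs (i l)) ->
    (exists s t : 'I_n, (s < t)%N /\ i s <> i t) ->
    kappa x = 0.

Definition Rtransform (x : prodAX P) : fps (dual K) :=
  fun n => if n is 0 then 0 else kappa (fun _ : 'I_n => x).

(* Division by z is a shift: the inverse series has no constant term. *)
Definition Stransform (x : prodAX P) : fps (dual K) :=
  fun n => comp_inv (Rtransform x) n.+1.

Lemma Rtransform1 x : Rtransform x 1%N = expectB x.
Proof.
rewrite /Rtransform /kappa /= big_ord1 big_pred0 ?subr0 // => g.
apply/negP => /andP[gNC gN].
have [/and3P[/eqP cg _ g0] _] := andP gNC.
have : ord0 \in cover g by rewrite cg inE.
case/bigcupP => B Bg B0; have := noncrossing_card_lt gNC gN Bg.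
by rewrite ltnS leqn0 cards_eq0 => /eqP BE; rewrite BE inE in B0.
Qed.

Lemma Stransform_comp_inv x : ncphi P (fstA x) != 0 ->
  is_comp_inv (Rtransform x) (comp_inv (Rtransform x)).
Proof.
by move=> x0; apply: comp_invP; rewrite // Rtransform1 dual_unitE.
Qed.

End Transforms.

(* Main.v *)
From HB Require Import structures.
Require Import Defs.
From mathcomp Require Import all_boot all_order all_algebra.
From mathcomp Require Import boolp reals complex ring.

(** Write x = x1, y = x2, and R_x, R_y, R_xy for the R-transforms of x, y, xy.

    Only two facts about the cumulants matter.  First, sorting the noncrossing
    partitions of a word by the block V of its first letter turns the
    moment-cumulant formula into a recursion: a moment is the sum, over the
    choices of V, of the cumulant of V times the moments of the gaps that V
    leaves, because noncrossing confines every other block to one gap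
    ([moment_cons]).  Second, by freeness V contributes only if all its letters
    are equal.

    Apply this to the alternating words.  Let M_x, M_y be the generating series
    of the moments of the words xyxy..xy and yxyx..yx, and N_x, N_y those of
    the words xyx..x and yxy..y of odd length, a word being counted by half its
    length, rounded down.  In a word starting with x, the block of the first
    letter consists of letters x, hence its gaps, except possibly the last, are
    odd words starting with y.  Summing the resulting geometric progressions gives
    [alt_series_even] and [alt_series_odd]:
      M_x = 1 + R_x(z N_y),            M_y = 1 + R_y(z N_x),
      z N_y N_x = R_x(z N_y) M_y,      z N_x N_y = R_y(z N_x) M_x.
    Subtracting the last two equations after inserting the first two shows that
    R_x(z N_y) and R_y(z N_x) are one and the same series t, whence M_x = 1 + t
    and (z N_y)(z N_x) = z t (1 + t).  The moments of xy are those of the words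
    (xy)^n, and the recursion for powers of one element says that
    M_x = 1 + R_xy(z M_x), i.e. R_xy(z (1 + t)) = t.  Let G_x, G_y, G_xy be the
    compositional inverses.  Then
      G_x(t) G_y(t) = (z N_y)(z N_x) = t z (1 + t) = t G_xy(t),
    and as t has an invertible linear coefficient it can be cancelled:
    z G_xy = G_x G_y ([comp_inv_mul]).  Dividing by z^2 gives the theorem. *)

Set Implicit Arguments.
Unset Strict Implicit.
Unset Printing Implicit Defensive.

Import GRing.Theory.

Local Open Scope ring_scope.

(** * Sums over noncrossing partitions *)

Section NoncrossingSums.

(** Subsets of one fixed ordinal type are used as index sets so that gaps and
    blocks of a word can be partitioned without changing the index type; for
    the full set this is [noncrossing] by definition. *)
Definition ncpart N (S : {set 'I_N}) (g : {set {set 'I_N}}) : bool :=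
  partition g S &&
  [forall B1 in g, forall B2 in g, (B1 != B2) ==>
    ~~ [exists i in B1, exists j in B2, exists k in B1, exists l in B2,
          [&& (i < j)%N, (j < k)%N & (k < l)%N]]].

Lemma ncpartP N (S : {set 'I_N}) (g : {set {set 'I_N}}) : reflect
  [/\ forall B, B \in g -> B != set0 /\ B \subset S,
      forall i, i \in S -> exists2 B, B \in g & i \in B,
      forall B1 B2 i, B1 \in g -> B2 \in g -> i \in B1 -> i \in B2 -> B1 = B2
    & forall B1 B2 (i j k l : 'I_N), B1 \in g -> B2 \in g ->
        i \in B1 -> j \in B2 -> k \in B1 -> l \in B2 ->
        (i < j)%N -> (j < k)%N -> (k < l)%N -> B1 = B2]
  (ncpart S g).
Proof.
apply: (iffP andP) => [[pg /'forall_implyP cf]|[sub cov uni cf]].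
  split=> [B Bg|i|B1 B2 i B1g B2g i1 i2
          |B1 B2 i j k l B1g B2g i1 j2 k1 l2 ij jk kl].
  - by rewrite (partition_neq0 pg Bg) (partitionS pg Bg).
  - by rewrite -(cover_partition pg) => /bigcupP[B Bg iB]; exists B.
  - have tg := partition_trivIset pg.
    by rewrite -(def_pblock tg B1g i1) (def_pblock tg B2g i2).
  - have /'forall_implyP/(_ B2 B2g) := cf B1 B1g.
    apply: contraTeq => B12; rewrite B12 /= negbK.
    apply/exists_inP; exists i => //; apply/exists_inP; exists j => //.
    apply/exists_inP; exists k => //; apply/exists_inP; exists l => //.
    by rewrite ij jk kl.
split.
  apply/and3P; split.
  - rewrite eqEsubset; apply/andP; split.
      by apply/bigcupsP => B /sub[].
    by apply/subsetP => i /cov[B Bg iB]; apply/bigcupP; exists B.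
  - apply/trivIsetP => B1 B2 B1g B2g; apply: contraR.
    by case/pred0Pn => i /andP[/= i1 i2]; apply/eqP/(uni _ _ i).
  - by apply/negP => /sub[]; rewrite eqxx.
apply/'forall_implyP => B1 B1g; apply/'forall_implyP => B2 B2g.
apply/implyP; apply: contraNN.
move=> /exists_inP[i i1] /exists_inP[j j2] /exists_inP[k k1] /exists_inP[l l2].
by case/and3P=> ij jk kl; apply/eqP/(cf _ _ i j k l).
Qed.

Variables (T : Type) (C : comNzRingType) (k : seq T -> C).

Definition subword N (x : 'I_N -> T) (B : {set 'I_N}) : seq T :=
  [seq x i | i <- enum B].

Definition block_prod N (x : 'I_N -> T) (g : {set {set 'I_N}}) : C :=
  \prod_(B in g) k (subword x B).

Definition ncsum N (x : 'I_N -> T) (S : {set 'I_N}) : C :=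
  \sum_(g | ncpart S g) block_prod x g.

(** No element of H lies between two elements of G, so noncrossing partitions of
    G and of H can be put together without creating a crossing.  The predicate Q
    singles out partitions by their restriction to H, and thus carries the
    condition on the first block through the factorization. *)
Lemma ncsum_split N (x : 'I_N -> T) (G H : {set 'I_N})
    (Q : pred {set {set 'I_N}}) :
  [disjoint G & H] ->
  (forall i j l : 'I_N, i \in G -> j \in H -> l \in G ->
     ~~ ((i < j)%N && (j < l)%N)) ->
  \sum_(g | [&& ncpart (G :|: H) g,
                [forall B in g, (B \subset G) || (B \subset H)]
              & Q (g ::&: H)]) block_prod x g
  = ncsum x G * \sum_(h | ncpart H h && Q h) block_prod x h.
Proof.
move=> dGH conv; rewrite big_distrlr /= pair_big /=.
have GHF i : i \in G -> i \in H -> False.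
  by move=> iG iH; have := disjointFr dGH iG; rewrite iH.
rewrite (reindex_onto (fun p => p.1 :|: p.2)
                      (fun g => (g ::&: G, g ::&: H))) /=.
  apply: eq_big => [[g1 g2]|[g1 g2]] /=.
    apply/idP/idP => [/andP[/and3P[nc resp Qg] /eqP[e1 e2]]|].
      move: nc => /ncpartP[sub cov uni cf].
      have in1 B : B \in g1 -> (B \in g1 :|: g2) /\ B \subset G.
        by rewrite -{1}e1 inE => /andP[].
      have in2 B : B \in g2 -> (B \in g1 :|: g2) /\ B \subset H.
        by rewrite -{1}e2 inE => /andP[].
      apply/and3P; split; last by rewrite e2 in Qg.
      - apply/ncpartP; split=> [B /in1[/sub[]]|i iG|B1 B2 i /in1[? _] /in1[? _]
          |B1 B2 i j m l /in1[? _] /in1[? _]] //; [|exact: uni|exact: cf].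
        have [|B Bg iB] := cov i; first by rewrite inE iG.
        exists B => //; move: Bg.
        rewrite inE => /orP[//|/in2[_ /subsetP/(_ _ iB)]].
        by move/(GHF _ iG).
      - apply/ncpartP; split=> [B /in2[/sub[]]|i iH|B1 B2 i /in2[? _] /in2[? _]
          |B1 B2 i j m l /in2[? _] /in2[? _]] //; [|exact: uni|exact: cf].
        have [|B Bg iB] := cov i; first by rewrite inE iH orbT.
        exists B => //; move: Bg.
        rewrite inE => /orP[/in1[_ /subsetP/(_ _ iB)]|//].
        by move=> iG; case: (GHF _ iG iH).
    case/and3P=> /ncpartP[sub1 cov1 uni1 cf1] /ncpartP[sub2 cov2 uni2 cf2] Qg.
    have in1 B i : B \in g1 -> i \in B -> i \in G.
      by move=> /sub1[_ /subsetP]; apply.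
    have in2 B i : B \in g2 -> i \in B -> i \in H.
      by move=> /sub2[_ /subsetP]; apply.
    have e1 : (g1 :|: g2) ::&: G = g1.
      apply/setP => B; rewrite !inE; apply/andP/idP => [[/orP[]//]|B1].
        move=> B2 /subsetP BG; have [/set0Pn[i iB] _] := sub2 _ B2.
        by case: (GHF i (BG _ iB) (in2 _ _ B2 iB)).
      by rewrite B1; have [] := sub1 _ B1.
    have e2 : (g1 :|: g2) ::&: H = g2.
      apply/setP => B; rewrite !inE; apply/andP/idP => [[/orP[]//]|B2].
        move=> B1 /subsetP BH; have [/set0Pn[i iB] _] := sub1 _ B1.
        by case: (GHF i (in1 _ _ B1 iB) (BH _ iB)).
      by rewrite B2 orbT; have [] := sub2 _ B2.
    rewrite e1 e2 eqxx Qg !andbT; apply/andP; split.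
      apply/ncpartP; split.
      - move=> B; rewrite inE => /orP[/sub1|/sub2] [-> sB]; split=> //.
          by apply: subset_trans sB _; apply: subsetUl.
        by apply: subset_trans sB _; apply: subsetUr.
      - move=> i; rewrite inE => /orP[/cov1|/cov2] [B Bg iB]; exists B => //.
          by rewrite inE Bg.
        by rewrite inE Bg orbT.
      - move=> B1 B2 i; rewrite !inE => /orP[] b1 /orP[] b2 i1 i2.
        + exact: uni1 i1 i2.
        + by case: (GHF i (in1 _ _ b1 i1) (in2 _ _ b2 i2)).
        + by case: (GHF i (in1 _ _ b2 i2) (in2 _ _ b1 i1)).
        + exact: uni2 i1 i2.
      - move=> B1 B2 i j m l; rewrite !inE.
        move=> /orP[] b1 /orP[] b2 i1 j2 m1 l2 ij jm ml.
        + exact: (cf1 _ _ i j m l).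
        + have := conv i j m (in1 _ _ b1 i1) (in2 _ _ b2 j2) (in1 _ _ b1 m1).
          by rewrite ij jm.
        + have := conv j m l (in1 _ _ b2 j2) (in2 _ _ b1 m1) (in1 _ _ b2 l2).
          by rewrite jm ml.
        + exact: (cf2 _ _ i j m l).
    apply/forall_inP => B; rewrite inE => /orP[/sub1|/sub2] [_ ->] //.
    by rewrite orbT.
  case/andP=> /and3P[nc _ _] /eqP[e1 e2].
  rewrite /block_prod -bigU /=; first by apply: eq_bigl => B; rewrite !inE.
  rewrite -setI_eq0; apply/eqP/setP => B; rewrite in_setI in_set0.
  apply/negP => /andP[b1 b2].
  move: nc => /ncpartP[sub _ _ _].
  have := b1; rewrite -e1 inE => /andP[Bg /subsetP BG].
  have := b2; rewrite -e2 inE => /andP[_ /subsetP BH].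
  have [/set0Pn[i iB] _] := sub B Bg.
  exact: (GHF i (BG _ iB) (BH _ iB)).
move=> g /and3P[/ncpartP[sub _ _ _] /forall_inP resp _].
apply/setP => B; rewrite !inE -andb_orr; case: (boolP (B \in g)) => //= Bg.
by rewrite resp.
Qed.

Lemma sorted_enum N (B : {set 'I_N}) :
  sorted (fun i j : 'I_N => (i < j)%N) (enum B).
Proof.
rewrite /enum_mem; apply: sorted_filter.
  by move=> ? ? ?; apply: ltn_trans.
rewrite -enumT -(@sorted_map _ _ (fun i : 'I_N => val i) ltn) val_enum_ord.
exact: iota_ltn_sorted.
Qed.

(** The enumeration of a set of ordinals is its only increasing listing; hence
    adding or removing an extreme element changes only one end of a subword. *)
Lemma sorted_eq_enum N (B : {set 'I_N}) (s : seq 'I_N) :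
  sorted (fun i j : 'I_N => (i < j)%N) s -> s =i B -> enum B = s.
Proof.
move=> ss sB; apply: (@irr_sorted_eq _ (fun i j : 'I_N => (i < j)%N)) => //.
- by move=> ? ? ?; apply: ltn_trans.
- by move=> i; rewrite /= ltnn.
- exact: sorted_enum.
- by move=> i; rewrite mem_enum sB.
Qed.

Lemma subword_rcons N (x : 'I_N -> T) (B : {set 'I_N}) (a : 'I_N) :
  (forall i, i \in B -> (i < a)%N) ->
  subword x (a |: B) = rcons (subword x B) (x a).
Proof.
move=> Ba; rewrite /subword -map_rcons; congr (map _ _); apply: sorted_eq_enum.
  have := sorted_enum B; have : {in enum B, forall i : 'I_N, (i < a)%N}.
    by move=> i; rewrite mem_enum; apply: Ba.
  case: (enum B) => [//|b s] bs; rewrite /= rcons_path => -> /=.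
  by apply: bs; rewrite mem_last.
by move=> i; rewrite mem_rcons !inE mem_enum.
Qed.

Lemma subword_cons N (x : 'I_N -> T) (B : {set 'I_N}) (a : 'I_N) :
  a \in B -> (forall i, i \in B -> (a <= i)%N) ->
  subword x B = x a :: subword x (B :\ a).
Proof.
move=> aB Ba; rewrite /subword -map_cons; congr (map _ _).
apply: sorted_eq_enum.
  rewrite /= path_min_sorted ?sorted_enum //; apply/allP => i.
  rewrite mem_enum !inE => /andP[ia iB].
  by rewrite ltn_neqAle Ba // andbT eq_sym.
by move=> i; rewrite !inE mem_enum !inE; case: eqVneq => //= ->.
Qed.

Lemma subword_imset N M (f : 'I_M -> 'I_N) (x : 'I_N -> T) (B : {set 'I_M}) :
  (forall i j : 'I_M, (i < j)%N -> (f i < f j)%N) ->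
  subword x (f @: B) = subword (x \o f) B.
Proof.
move=> fM; rewrite /subword (map_comp x f); congr [seq x i | i <- _].
apply: sorted_eq_enum.
  exact: homo_sorted (sorted_enum B).
move=> i; apply/mapP/imsetP => -[j jB ->]; exists j => //; move: jB;
  by rewrite mem_enum.
Qed.

(** Under an increasing map, blocks, crossings and subwords all correspond. *)
Lemma ncsum_imset N M (f : 'I_M -> 'I_N) (x : 'I_N -> T) (S : {set 'I_M}) :
  (forall i j : 'I_M, (i < j)%N -> (f i < f j)%N) ->
  ncsum x (f @: S) = ncsum (x \o f) S.
Proof.
move=> fM.
have fI : injective f.
  move=> i j fij; apply: val_inj; case: (ltngtP i j) => // /fM;
  by rewrite fij ltnn.
have fS (i j : 'I_M) : (f i < f j)%N -> (i < j)%N.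
  by case: (ltngtP i j) => // [/fM|/val_inj ->]; rewrite ?ltnn //; case: ltngtP.
have FI : injective (fun B : {set 'I_M} => f @: B) := imset_inj fI.
rewrite /ncsum (reindex_onto
  (fun g : {set {set 'I_M}} => [set f @: (B : {set 'I_M}) | B in g])
  (fun h : {set {set 'I_N}} => [set f @^-1: (B : {set 'I_N}) | B in h])) /=;
  last first.
  move=> h /ncpartP[sub _ _ _]; rewrite -imset_comp /= -[RHS]imset_id.
  apply: eq_in_imset => B /sub[_ Bf] /=; apply/setP => i.
  apply/imsetP/idP => [[j]|iB]; first by rewrite inE => fj ->.
  have /imsetP[j _ ij] := subsetP Bf _ iB.
  by exists j; rewrite // inE -ij.
apply: eq_big => [g|g _]; last first.
  rewrite /block_prod big_imset /=; last by move=> ? ? _ _ /FI.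
  by apply: eq_bigr => B _; rewrite subword_imset.
rewrite -imset_comp [X in _ && (X == _)](_ : _ = g) ?eqxx ?andbT; last first.
  rewrite -[RHS]imset_id; apply: eq_imset => B /=.
  by apply/setP => i; rewrite inE mem_imset.
rewrite /ncpart imset_partition //; congr (_ && _).
apply/'forall_implyP/'forall_implyP => cf B1 B1g;
  apply/'forall_implyP => B2 B2g; apply/implyP => B12.
- have /'forall_implyP/(_ (f @: B2)) := cf (f @: B1) (imset_f _ B1g).
  rewrite imset_f // (inj_eq FI) B12 => /(_ isT); apply: contra.
  move=> /exists_inP[i i1] /exists_inP[j j2].
  move=> /exists_inP[m m1] /exists_inP[l l2].
  case/and3P=> ij jm ml.
  apply/exists_inP; exists (f i); first exact: imset_f.
  apply/exists_inP; exists (f j); first exact: imset_f.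
  apply/exists_inP; exists (f m); first exact: imset_f.
  apply/exists_inP; exists (f l); first exact: imset_f.
  by rewrite !fM.
- move: B1g B2g B12 => /imsetP[D1 D1g ->] /imsetP[D2 D2g ->].
  rewrite (inj_eq FI) => D12.
  have /'forall_implyP/(_ D2 D2g) := cf D1 D1g.
  rewrite D12; apply: contra.
  move=> /exists_inP[_ /imsetP[i i1 ->]] /exists_inP[_ /imsetP[j j2 ->]].
  move=> /exists_inP[_ /imsetP[m m1 ->]] /exists_inP[_ /imsetP[l l2 ->]].
  case/and3P=> /fS ij /fS jm /fS ml.
  apply/exists_inP; exists i => //; apply/exists_inP; exists j => //.
  apply/exists_inP; exists m => //; apply/exists_inP; exists l => //.
  by rewrite ij jm ml.
Qed.

Definition moment (s : seq T) : C :=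
  ncsum (tnth (in_tuple s)) [set: 'I_(size s)].

(** By transport along the enumeration of S, a sum over the noncrossing
    partitions of S only sees the word that S spells. *)
Lemma ncsum_moment N (x : 'I_N -> T) (S : {set 'I_N}) :
  ncsum x S = moment (subword x S).
Proof.
have e : size (subword x S) = #|S| by rewrite size_map -cardE.
pose f (i : 'I_(size (subword x S))) := enum_val (cast_ord e i).
have szE (i : 'I_(size (subword x S))) : (i < size (enum S))%N.
  by rewrite -cardE -e.
have fE (y : 'I_N) i : f i = nth y (enum S) i.
  by rewrite /f /enum_val; apply: set_nth_default; apply: szE.
have xf : x \o f = tnth (in_tuple (subword x S)).
  apply: funext => i /=; rewrite (tnth_nth (x (f i))) /= /subword.
  by rewrite (nth_map (f i)) ?szE // -fE.
rewrite /moment -xf -ncsum_imset.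
  congr (ncsum _ _); apply/setP => i; apply/idP/imsetP => [iS|[j _ ->]].
    exists (cast_ord (esym e) (enum_rank_in iS i)) => //.
    by rewrite /f cast_ordKV enum_rankK_in.
  exact: enum_valP.
move=> i j ij; have y := f i; rewrite !(fE y).
apply: (sorted_ltn_nth _ _ (sorted_enum S)); rewrite ?inE ?szE //.
by move=> ? ? ?; apply: ltn_trans.
Qed.

(** The state of a left-to-right scan that builds the first block: V is what
    has been put into it, G is the gap opened since the last element of V, and
    the elements of S are still undecided. *)
Definition first_block_setsum N (x : 'I_N -> T) (V G S : {set 'I_N}) : C :=
  \sum_(g | ncpart (V :|: G :|: S) g &&
            [exists B in g, (V \subset B) && [disjoint B & G]]) block_prod x g.

(** Nothing is undecided: V is a block and what remains is a partition of the
    gap G. *)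
Lemma first_block_setsum0 N (x : 'I_N -> T) (V G : {set 'I_N}) :
  V != set0 -> (forall i j : 'I_N, i \in V -> j \in G -> (i < j)%N) ->
  first_block_setsum x V G set0 = ncsum x G * k (subword x V).
Proof.
move=> V0 VG; pose Q (h : {set {set 'I_N}}) := [exists B in h, V \subset B].
have dVG : [disjoint G & V].
  rewrite -setI_eq0; apply/eqP/setP => i; rewrite in_setI in_set0.
  by apply/negP => /andP[/VG/[apply]]; rewrite ltnn.
rewrite [k _](_ : _ = \sum_(h | ncpart V h && Q h) block_prod x h); last first.
  rewrite (big_pred1 [set V]) ?/block_prod ?big_set1 // => h.
  apply/andP/eqP => [[/ncpartP[sub cov uni _] /exists_inP[B Bh VB]]|->].
    have BV : B = V by apply/eqP; rewrite eqEsubset VB; have [_ ->] := sub B Bh.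
    subst B; apply/setP => B; rewrite inE; apply/idP/eqP => [Bh'|-> //].
    have [/set0Pn[i iB] /subsetP BV] := sub B Bh'.
    exact: uni (BV _ iB).
  split; last by apply/exists_inP; exists V; rewrite ?inE.
  apply/ncpartP; split=> [B|i iV|B1 B2 i|B1 B2 i j m l].
  - by rewrite inE => /eqP->.
  - by exists V; rewrite ?inE.
  - by rewrite !inE => /eqP-> /eqP->.
  - by rewrite !inE => /eqP-> /eqP->.
rewrite -ncsum_split //; last first.
  move=> i j l iG jV _; apply/negP => /andP[].
  by have := VG j i jV iG; case: ltngtP.
rewrite /first_block_setsum setU0; apply: eq_bigl => g; rewrite (setUC G V).
apply/andP/and3P => [[nc /exists_inP[B Bg /andP[VB dB]]]|[nc resp]].
  split=> //.
    have /ncpartP[sub cov uni _] := nc.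
    apply/forall_inP => D Dg; have [D0 /subsetP Ds] := sub D Dg.
    have [->|DB] := eqVneq D B; apply/orP; [right|left].
      apply/subsetP => i iB; have [_ /subsetP/(_ i iB)] := sub B Bg.
      by rewrite inE (disjointFr dB iB) orbF.
    apply/subsetP => i iD; have := Ds _ iD; rewrite inE => /orP[|//] iV.
    by move/eqP: DB; case; apply: (uni _ _ i) => //; apply: (subsetP VB).
  apply/exists_inP; exists B => //; rewrite inE Bg /=.
  have /ncpartP[sub _ _ _] := nc.
  apply/subsetP => i iB; have [_ /subsetP/(_ i iB)] := sub B Bg.
  by rewrite inE (disjointFr dB iB) orbF.
move=> /exists_inP[B]; rewrite inE => /andP[Bg BV] VB; split=> //.
apply/exists_inP; exists B; rewrite // VB /=.
have -> : B = V by apply/eqP; rewrite eqEsubset VB BV.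
by rewrite disjoint_sym.
Qed.

(** Either the next element a stays out of the first block and enlarges the gap,
    or it joins the block and closes the gap.  In the second case a block with
    points both inside and after the gap would cross the first block, whose
    elements V and a surround the gap; so the gap is partitioned
    independently of the rest. *)
Lemma first_block_setsumS N (x : 'I_N -> T) (V G S : {set 'I_N}) (a : 'I_N) :
  V != set0 -> (forall i j : 'I_N, i \in V -> j \in G -> (i < j)%N) ->
  (forall i : 'I_N, i \in V :|: G -> (i < a)%N) ->
  a \in S -> (forall i : 'I_N, i \in S -> (a <= i)%N) ->
  first_block_setsum x V G S = first_block_setsum x V (a |: G) (S :\ a)
    + ncsum x G * first_block_setsum x (a |: V) set0 (S :\ a).
Proof.
move=> V0 VG VGa aS Sa.
have Va i : i \in V -> (i < a)%N by move=> iV; apply: VGa; rewrite inE iV.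
have Ga i : i \in G -> (i < a)%N by move=> iG; apply: VGa; rewrite inE iG orbT.
rewrite [LHS](bigID (fun g : {set {set 'I_N}} =>
  [exists B in g, (a |: V \subset B) && [disjoint B & G]])) /= addrC.
congr (_ + _).
  apply: eq_bigl => g.
  have -> : V :|: (a |: G) :|: S :\ a = V :|: G :|: S.
    apply/setP => i; rewrite !inE; case: (eqVneq i a) => [->|] //=.
    by rewrite aS !orbT.
  rewrite -andbA; case: (boolP (ncpart _ g)) => //= /ncpartP[sub cov uni _].
  apply/andP/exists_inP =>
    [[/exists_inP[B Bg /andP[VB BG]] nex]|[B Bg /andP[VB BG]]].
    exists B => //; rewrite VB /= -setI_eq0; apply/eqP/setP => i.
    rewrite !inE; case: (boolP (i \in B)) => //= iB.
    rewrite (disjointFr BG iB) orbF.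
    apply: contraNF nex => /eqP ia; apply/exists_inP; exists B => //.
    by rewrite BG andbT subUset VB sub1set -ia iB.
  have BG' : [disjoint B & G].
    by apply: disjointWr BG; apply: subsetUr.
  split; first by apply/exists_inP; exists B; rewrite // VB.
  apply/exists_inP => -[D Dg /andP[]].
  rewrite subUset sub1set => /andP[aD VD] _.
  have [i iV] := set0Pn _ V0.
  have DB : D = B.
    by apply: (uni _ _ i) => //; [apply: (subsetP VD)|apply: (subsetP VB)].
  by have := disjointFr BG (_ : a \in B); rewrite -DB aD !inE eqxx => /(_ isT).
pose H := a |: V :|: set0 :|: S :\ a.
have HE i : (i \in H) = (i \in V) || (i \in S).
  rewrite !inE orbF; case: (eqVneq i a) => [->|] /=; by rewrite ?aS ?orbT.
have dGH : [disjoint G & H].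
  rewrite -setI_eq0; apply/eqP/setP => i; rewrite in_setI in_set0 HE.
  apply/negP => /andP[iG /orP[iV|/Sa]].
    by have := VG i i iV iG; rewrite ltnn.
  by rewrite leqNgt Ga.
rewrite /first_block_setsum -/H -ncsum_split //; last first.
  move=> i j l iG; rewrite HE => jH lG; apply/negP => /andP[ij jl].
  case/orP: jH => [jV|/Sa].
    by have := VG j i jV iG; move: ij; case: ltngtP.
  by rewrite leqNgt (ltn_trans jl) ?Ga.
apply: eq_bigl => g.
have -> : G :|: H = V :|: G :|: S.
  by apply/setP => i; rewrite in_setU HE !inE orbCA orbA.
case: (boolP (ncpart _ g)) => //= /ncpartP[sub cov uni cf].
apply/andP/andP => [[_ /exists_inP[B Bg /andP[VB BG]]]
                   |[/forall_inP resp /exists_inP[B]]].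
  have BH : B \subset H.
    apply/subsetP => i iB; rewrite HE; have [_ /subsetP/(_ i iB)] := sub B Bg.
    by rewrite !inE (disjointFr BG iB) orbF.
  split; last first.
    apply/exists_inP; exists B; first by rewrite inE Bg BH.
    by rewrite VB -setI_eq0 setI0 eqxx.
  apply/forall_inP => D Dg; apply/orP.
  have [/subsetP Ds] := (sub D Dg).2.
  have [->|DB] := eqVneq D B; first by right.
  have DV i : i \in D -> i \in V -> False.
    move=> iD iV; move/eqP: DB; case; apply: (uni _ _ i) => //.
    by apply: (subsetP VB); rewrite inE iV orbT.
  case: (boolP (D \subset G)) => [|/subsetPn[j jD jG]]; [by left|right].
  apply/subsetP => i iD; rewrite HE; have := Ds i iD; rewrite !inE.
  case/orP => [|->]; last by rewrite orbT.
  case/orP => [->//|iG]; have [v vV] := set0Pn _ V0.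
  have jS : j \in S.
    have := Ds j jD; rewrite !inE (negbTE jG) orbF => /orP[/(DV j jD)|] //.
  have aB : a \in B by apply: (subsetP VB); rewrite !inE eqxx.
  have aj : (a < j)%N.
    rewrite ltn_neqAle Sa // andbT; apply: contra_neqN DB => /eqP/val_inj ej.
    by apply: (uni _ _ j) => //; rewrite -ej.
  (* v < i < a < j with v and a in B, i and j in D: the blocks cross. *)
  case: (negP DB); apply/eqP/esym; apply: (cf _ _ v i a j) => //.
  - by apply: (subsetP VB); rewrite inE vV orbT.
  - exact: VG.
  - exact: Ga.
rewrite inE => /andP[Bg BH] /andP[VB _].
have BG : [disjoint B & G].
  rewrite disjoint_sym; apply: disjointWr dGH; exact: BH.
split.
  apply/exists_inP; exists B => //.
  by rewrite BG andbT (subset_trans _ VB) ?subsetUr.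
by apply/exists_inP; exists B; rewrite // VB.
Qed.

(** The same scan on words: u is the first block so far, v the open gap, w the
    undecided letters. *)
Fixpoint first_block_sum (u v w : seq T) : C :=
  if w is a :: w' then
    first_block_sum u (rcons v a) w' +
    moment v * first_block_sum (rcons u a) [::] w'
  else moment v * k u.

Lemma first_block_sum_cons u v a w : first_block_sum u v (a :: w) =
  first_block_sum u (rcons v a) w +
  moment v * first_block_sum (rcons u a) [::] w.
Proof. by []. Qed.

Lemma first_block_setsumE N (x : 'I_N -> T) (V G S : {set 'I_N}) :
  V != set0 -> (forall i j : 'I_N, i \in V -> j \in G -> (i < j)%N) ->
  (forall i j : 'I_N, i \in V :|: G -> j \in S -> (i < j)%N) ->
  first_block_setsum x V G S =
    first_block_sum (subword x V) (subword x G) (subword x S).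
Proof.
have [n] := ubnP #|S|; elim: n V G S => // n IH V G S Sn V0 VG VGS.
have [->|/set0Pn[a0 a0S]] := eqVneq S set0.
  by rewrite first_block_setsum0 // {4}/subword enum_set0 /= ncsum_moment.
have [a aS amin] : exists2 a, a \in S & forall i : 'I_N, i \in S -> (a <= i)%N.
  by have [a] := arg_minnP (fun i : 'I_N => i : nat) a0S; exists a.
have VGa i : i \in V :|: G -> (i < a)%N by move=> /VGS/(_ aS).
have Sa (i : 'I_N) : i \in S :\ a -> (a < i)%N.
  by rewrite !inE => /andP[ia iS]; rewrite ltn_neqAle eq_sym ia amin.
have Sn' : (#|S :\ a| < n)%N by move: Sn; rewrite (cardsD1 a S) aS.
rewrite (@first_block_setsumS _ _ _ _ _ a) // (subword_cons _ aS) //.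
rewrite IH //=; last 2 first.
- move=> i j iV; rewrite !inE => /orP[/eqP->|/(VG _ _ iV)] //.
  by apply: VGa; rewrite inE iV.
- move=> i j iVG /Sa; have [-> //|ia] := eqVneq i a; apply: ltn_trans.
  by apply: VGa; move: iVG; rewrite !inE (negbTE ia).
rewrite IH //; last 3 first.
- by apply/set0Pn; exists a; rewrite !inE eqxx.
- by move=> i j _; rewrite inE.
- move=> i j iV /Sa; have [-> //|ia] := eqVneq i a; apply: ltn_trans.
  by apply: VGa; move: iV; rewrite !inE (negbTE ia) orbF => /= ->.
rewrite subword_rcons; last by move=> i iG; apply: VGa; rewrite inE iG orbT.
rewrite subword_rcons; last by move=> i iV; apply: VGa; rewrite inE iV.
by rewrite ncsum_moment [subword x set0]/subword enum_set0.
Qed.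

(** The first-block recursion; expanding the scan gives the sum over all blocks
    containing the first letter. *)
Lemma moment_cons (a : T) (w : seq T) :
  moment (a :: w) = first_block_sum [:: a] [::] w.
Proof.
pose x := tnth (in_tuple (a :: w)); pose V : {set 'I_(size w).+1} := [set ord0].
have wE : [seq x i | i <- enum 'I_(size w).+1] = a :: w.
  exact: (map_tnth_enum (in_tuple (a :: w))).
have e0 : subword x V = [:: a].
  by rewrite /subword /V enum_set1.
have eS : subword x [set: 'I_(size w).+1] = a :: w.
  by rewrite /subword enum_setT -enumT.
have eS' : subword x (setT :\ ord0) = w.
  have := subword_cons x (in_setT ord0); rewrite eS.
  by move=> /(_ (fun _ _ => leq0n _)) [].
rewrite -{2}eS' -e0 (_ : [::] = subword x set0); last first.
  by rewrite /subword enum_set0.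
rewrite -first_block_setsumE; last 3 first.
- by apply/set0Pn; exists ord0; rewrite inE.
- by move=> i j _; rewrite inE.
- by move=> i j; rewrite !inE orbF andbT => /eqP-> /=; rewrite lt0n.
rewrite /moment /ncsum /first_block_setsum; apply: eq_bigl => g.
have -> : V :|: set0 :|: setT :\ ord0 = setT.
  by apply/setP => i; rewrite !inE; case: eqP.
case: (boolP (ncpart _ g)) => //= /ncpartP[_ cov _ _].
have [B Bg oB] := cov ord0 (in_setT _).
by apply/esym/exists_inP; exists B; rewrite // sub1set oB -setI_eq0 setI0 eqxx.
Qed.

Lemma moment_nil : moment [::] = 1.
Proof.
rewrite /moment /ncsum (big_pred1 set0) /=.
  by rewrite /block_prod big_set0.
move=> g; apply/idP/eqP => [/ncpartP[sub _ _ _]|->].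
  apply/setP => B; rewrite inE; apply/negP => /sub[/set0Pn[[]]] //.
apply/ncpartP; split=> [B|[]|B1 B2 i|B1 B2 i j m l] //; by rewrite inE.
Qed.

End NoncrossingSums.

(** * The ring of formal power series *)

Section FpsRing.
Variable A : comUnitRingType.
Implicit Types F G H : fps A.

HB.instance Definition _ := gen_eqMixin (fps A).
HB.instance Definition _ := gen_choiceMixin (fps A).

Definition fps_add F G : fps A := fun n => F n + G n.
Definition fps_opp F : fps A := fun n => - F n.

Fact fps_addA : associative fps_add.
Proof. by move=> F G H; apply: funext => n; apply: addrA. Qed.
Fact fps_addC : commutative fps_add.
Proof. by move=> F G; apply: funext => n; apply: addrC. Qed.
Fact fps_add0 : left_id ((fun=> 0) : fps A) fps_add.
Proof. by move=> F; apply: funext => n; apply: add0r. Qed.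
Fact fps_addN : left_inverse ((fun=> 0) : fps A) fps_opp fps_add.
Proof. by move=> F; apply: funext => n; apply: addNr. Qed.
HB.instance Definition _ :=
  GRing.isZmodule.Build (fps A) fps_addA fps_addC fps_add0 fps_addN.

Lemma fps_mul_trunc m F G n : (n < m)%N ->
  fps_mul F G n = (fps_trunc m F * fps_trunc m G)`_n.
Proof.
move=> nm; rewrite coefM; apply: eq_bigr => j _.
by rewrite !coef_trunc ?(leq_ltn_trans (leq_subr _ _)) ?(leq_trans (ltn_ord j)).
Qed.

Lemma cong_trunc_mul m F G :
  cong_upto m (fps_trunc m (fps_mul F G)) (fps_trunc m F * fps_trunc m G).
Proof. by move=> i im; rewrite coef_trunc // (fps_mul_trunc _ _ im). Qed.

Fact fps_mulA : associative (@fps_mul A).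
Proof.
move=> F G H; apply: funext => n; have nn := ltnSn n.
rewrite !(fps_mul_trunc _ _ nn).
rewrite (cong_upto_mul (fun _ _ => erefl) (cong_trunc_mul G H)) // mulrA.
by rewrite (cong_upto_mul (cong_trunc_mul F G) (fun _ _ => erefl)).
Qed.
Fact fps_mulC : commutative (@fps_mul A).
Proof.
move=> F G; apply: funext => n.
by rewrite !(fps_mul_trunc _ _ (ltnSn n)) mulrC.
Qed.
Fact fps_mul1 : left_id (@fps_one A) (@fps_mul A).
Proof.
move=> F; apply: funext => n; rewrite /fps_mul big_ord_recl subn0 mul1r.
by rewrite big1 ?addr0 // => i _; rewrite mul0r.
Qed.
Fact fps_mulDl : left_distributive (@fps_mul A) fps_add.
Proof.
move=> F G H; apply: funext => n; rewrite /fps_mul /fps_add -big_split /=.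
by apply: eq_bigr => i _; rewrite mulrDl.
Qed.
Fact fps_one_neq0 : @fps_one A != 0.
Proof.
apply/eqP => /(congr1 (fun F : fps A => F 0%N)) /eqP.
by rewrite /fps_one oner_eq0.
Qed.
HB.instance Definition _ := GRing.Zmodule_isComNzRing.Build (fps A)
  fps_mulA fps_mulC fps_mul1 fps_mulDl fps_one_neq0.

Definition fps_const (a : A) : fps A := fun n => if n is 0 then a else 0.
Definition fps_shift F : fps A := fun n => F n.+1.

Lemma fps_coefD F G n : (F + G) n = F n + G n. Proof. by []. Qed.
Lemma fps_coefM F G n : (F * G) n = \sum_(i < n.+1) F i * G (n - i)%N.
Proof. by []. Qed.
Lemma fps_coef0M F G : (F * G) 0%N = F 0%N * G 0%N.
Proof. by rewrite fps_coefM big_ord1. Qed.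

Lemma fps_coef_constM a F n : (fps_const a * F) n = a * F n.
Proof.
rewrite fps_coefM big_ord_recl subn0 big1 ?addr0 // => i _.
by rewrite mul0r.
Qed.

Lemma fps_coef_XM F n : (@fps_X A * F) n = if n is n'.+1 then F n' else 0.
Proof.
rewrite fps_coefM big_ord_recl /fps_X mul0r add0r.
case: n => [|n]; first by rewrite big_ord0.
rewrite big_ord_recl mul1r subSS subn0 big1 ?addr0 // => i _.
by rewrite mul0r.
Qed.

Lemma fps_shiftE F : F = fps_const (F 0%N) + @fps_X A * fps_shift F.
Proof.
by apply: funext => -[|n]; rewrite fps_coefD fps_coef_XM ?addr0 //= add0r.
Qed.

Lemma fps_compD F G H : fps_comp (F + G) H = fps_comp F H + fps_comp G H.
Proof.
apply: funext => n; rewrite fps_coefD /fps_comp -big_split /=.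
by apply: eq_bigr => i _; rewrite fps_coefD mulrDl.
Qed.

Lemma fps_compM F G H : H 0%N = 0 ->
  fps_comp (F * G) H = fps_comp F H * fps_comp G H.
Proof.
move=> H0; apply: funext => n; have nn := ltnSn n.
have TH0 : (fps_trunc n.+1 H)`_0 = 0 by rewrite coef_trunc.
rewrite (fps_comp_trunc _ _ nn) //.
rewrite (cong_upto_comp TH0 TH0 (cong_trunc_mul F G) (fun _ _ => erefl)) //.
rewrite comp_polyM -[RHS]/(fps_mul _ _ n) (fps_mul_trunc _ _ nn).
apply: (@cong_upto_mul _ n.+1) => //.
  by move=> i im; rewrite coef_trunc // (fps_comp_trunc _ _ im).
by move=> i im; rewrite coef_trunc // (fps_comp_trunc _ _ im).
Qed.

Lemma fps_comp_const a H : fps_comp (fps_const a) H = fps_const a.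
Proof.
apply: funext => n; rewrite /fps_comp big_ord_recl /= big1; last first.
  by move=> i _; rewrite mul0r.
by rewrite addr0 /fps_one; case: n => [|n]; rewrite ?mulr1 ?mulr0.
Qed.

Lemma fps_comp_shift F H : H 0%N = 0 ->
  fps_comp F H = fps_const (F 0%N) + H * fps_comp (fps_shift F) H.
Proof.
move=> H0; rewrite {1}(fps_shiftE F) fps_compD fps_comp_const fps_compM //.
by rewrite fps_Xcomp.
Qed.

Lemma fps_comp_at0 F H : fps_comp F H 0%N = F 0%N.
Proof. by rewrite /fps_comp big_ord1 mulr1. Qed.

(** Iterating the recursion gives Z 0 = (c 0 + c 1 u + c 2 u^2 + ...) w, where
    the remainder u^s Z s tends to 0 because u has no constant term. *)
Lemma fps_linear_recursion (c : fps A) (u w : fps A) (Z : nat -> fps A) :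
  u 0%N = 0 ->
  (forall s, Z s = fps_const (c s) * w + u * Z s.+1) ->
  Z 0%N = fps_comp c u * w.
Proof.
move=> u0 ZE; pose D s := Z s - fps_comp (fun n => c (s + n)%N) u * w.
have DE s : D s = u * D s.+1.
  rewrite /D ZE fps_comp_shift // addn0.
  have -> : fps_shift (fun n => c (s + n)%N) = (fun n => c (s.+1 + n)%N).
    by apply: funext => n; rewrite /fps_shift addnS.
  by ring.
have D0 n s : D s n = 0.
  elim/ltn_ind: n s => n IH s; rewrite DE fps_coefM big1 // => -[[|i] /= ni] _.
    by rewrite u0 mul0r.
  rewrite IH ?mulr0 //; move: ni; rewrite ltnS => ni.
  by rewrite ltn_subrL (leq_ltn_trans _ ni).
have : D 0%N = 0 by apply: funext => n; apply: D0.
by move/eqP; rewrite subr_eq0 => /eqP.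
Qed.

End FpsRing.

(** * Moment series of powers and of alternating words *)

Section Words.
Variables (T : Type) (C : comUnitRingType) (k : seq T -> C).
Local Notation m := (moment k).
Local Notation fbs := (first_block_sum k).

(** The terms are sorted by the number l of letters skipped before the first
    block takes its next letter; in the isolated term it takes none. *)
Lemma fbs_nseq (a : T) s i j :
  fbs (nseq s.+1 a) (nseq i a) (nseq j a) =
    m (nseq (i + j) a) * k (nseq s.+1 a)
    + \sum_(l < j) m (nseq (i + l) a)
                   * fbs (nseq s.+2 a) [::] (nseq (j - l.+1) a).
Proof.
have nS n : rcons (nseq n a) a = nseq n.+1 a by elim: n => //= n ->.
elim: j i => [|j IH] i; first by rewrite big_ord0 addn0 addr0.
rewrite [nseq j.+1 a]/= first_block_sum_cons !nS IH big_ord_recl addn0 subSS.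
rewrite subn0 -addSnnS -addrA.
congr (_ + _); rewrite addrC; congr (_ + _).
by apply: eq_bigr => l _; rewrite -addSnnS subSS.
Qed.

(** The R-transform divided by z. *)
Definition cumulant_series (a : T) : fps C := fun n => k (nseq n.+1 a).

(** The gaps left by the first block of a power of a are powers of a. *)
Lemma moment_series_eq (a : T) (M : fps C) :
  (forall n, M n = m (nseq n a)) ->
  M = 1 + fps_comp (@fps_X C * cumulant_series a) (@fps_X C * M).
Proof.
move=> ME; have u0 : (@fps_X C * M) 0%N = 0 by rewrite fps_coef_XM.
(* Z s sums over the completions of a first block that has s + 1 letters. *)
pose Z s : fps C := fun n => fbs (nseq s.+1 a) [::] (nseq n a).
have ZE s : Z s = fps_const (cumulant_series a s) * M + @fps_X C * M * Z s.+1.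
  apply: funext => n; rewrite fps_coefD fps_coef_constM mulrC -mulrA fps_coef_XM.
  rewrite /Z (fbs_nseq a s 0 n) -ME; congr (_ + _).
  case: n => [|n]; first by rewrite big_ord0.
  by rewrite fps_coefM; apply: eq_bigr => l _; rewrite subSS ME.
have Z0 := fps_linear_recursion u0 ZE.
rewrite fps_compM // fps_Xcomp // -mulrA [M * _]mulrC -Z0.
apply: funext => -[|n]; rewrite fps_coefD fps_coef_XM ME /=.
  by rewrite moment_nil addr0.
by rewrite add0r moment_cons.
Qed.

End Words.

Section AlternatingWords.
Variables (C : comUnitRingType) (k : seq bool -> C).
Hypothesis k_mixed : forall w, true \in w -> false \in w -> k w = 0.
Local Notation m := (moment k).
Local Notation fbs := (first_block_sum k).

Fixpoint alt (b : bool) (n : nat) : seq bool :=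
  if n is n'.+1 then b :: alt (~~ b) n' else [::].

Lemma rcons_alt b n : rcons (alt b n) (odd n (+) b) = alt b n.+1.
Proof.
elim: n b => [|n IH] b //=.
by rewrite -[RHS]/(b :: alt (~~ b) n.+1) -IH addNb addbN.
Qed.

Lemma fbs_mixed u v w : true \in u -> false \in u -> fbs u v w = 0.
Proof.
elim: w u v => [|a w IH] u v ut uf /=; first by rewrite k_mixed // mulr0.
by rewrite !IH ?mulr0 ?addr0 // mem_rcons inE ?ut ?uf orbT.
Qed.

Lemma fbs_mixed_rcons b s v w : fbs (rcons (nseq s.+1 b) (~~ b)) v w = 0.
Proof. by apply: fbs_mixed; rewrite mem_rcons !inE; case: b. Qed.

(** The first block takes only letters b, so each gap that it closes is an odd
    alternating word starting with the other letter; p is the parity of the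
    length of the undecided word, which closing such a gap preserves. *)
Lemma fbs_alt (p b : bool) s i j :
  fbs (nseq s.+1 b) (alt (~~ b) i.*2) (alt (~~ b) (p + j.*2)) =
    m (alt (~~ b) (p + (i + j).*2)) * k (nseq s.+1 b)
    + \sum_(l < j) m (alt (~~ b) (i + l).*2.+1)
                   * fbs (nseq s.+2 b) [::] (alt (~~ b) (p + (j - l.+1).*2)).
Proof.
have r1 n : rcons (alt (~~ b) n.*2) (~~ b) = alt (~~ b) n.*2.+1.
  by rewrite -rcons_alt odd_double.
have r2 n : rcons (alt (~~ b) n.*2.+1) b = alt (~~ b) n.+1.*2.
  by rewrite doubleS -[RHS]rcons_alt /= odd_double /= negbK.
have nS n : rcons (nseq n b) b = nseq n.+1 b by elim: n => //= n ->.
elim: j i => [|j IH] i.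
  rewrite big_ord0 !addn0 addr0; case: p => //.
  rewrite -[alt (~~ b) true]/([:: ~~ b]) first_block_sum_cons.
  by rewrite fbs_mixed_rcons mulr0 addr0 r1.
rewrite addnC doubleS 2!addSn [alt _ _.+2]/= negbK first_block_sum_cons.
rewrite fbs_mixed_rcons mulr0 addr0 first_block_sum_cons r1 r2 nS.
rewrite addnC IH big_ord_recl addn0 subSS subn0 addSnnS -addrA.
congr (_ + _); rewrite addrC; congr (_ + _).
by apply: eq_bigr => l _; rewrite -addSnnS subSS.
Qed.

(** Generating series of the moments of the alternating words that start with b
    and whose length has parity p, counted by half the length. *)
Definition alt_series (p b : bool) : fps C := fun n => m (alt b (p + n.*2)).

(** The block of the first letter b closes gaps that are odd words, which give the
    powers of z N; the word after its last letter gives the final factor and has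
    the parity p of what followed the first letter. *)
Lemma fbs_alt_series (p b : bool) :
  (fun n => fbs [:: b] [::] (alt (~~ b) (p + n.*2))) =
  fps_comp (cumulant_series k b) (@fps_X C * alt_series true (~~ b))
    * alt_series p (~~ b).
Proof.
pose Z s : fps C := fun n => fbs (nseq s.+1 b) [::] (alt (~~ b) (p + n.*2)).
apply: (@fps_linear_recursion _ _ _ _ Z) => [|s]; first by rewrite fps_coef_XM.
apply: funext => n; rewrite fps_coefD fps_coef_constM mulrC -mulrA fps_coef_XM.
rewrite /Z (fbs_alt p b s 0 n); congr (_ + _).
case: n => [|n]; first by rewrite big_ord0.
by rewrite fps_coefM; apply: eq_bigr => l _; rewrite subSS.
Qed.

Lemma alt_series_odd b : alt_series true b =
  fps_comp (cumulant_series k b) (@fps_X C * alt_series true (~~ b))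
    * alt_series false (~~ b).
Proof.
rewrite -(fbs_alt_series false); apply: funext => n.
by rewrite /alt_series moment_cons.
Qed.

Lemma alt_series_even b : alt_series false b =
  1 + fps_comp (@fps_X C * cumulant_series k b)
               (@fps_X C * alt_series true (~~ b)).
Proof.
rewrite fps_compM ?fps_Xcomp ?fps_coef_XM // -mulrA [alt_series _ _ * _]mulrC.
rewrite -(fbs_alt_series true).
apply: funext => -[|n]; rewrite fps_coefD fps_coef_XM /alt_series /=.
  by rewrite moment_nil addr0.
by rewrite add0r moment_cons.
Qed.

End AlternatingWords.

(** * The functional equations determine the S-transform *)

Section Multiplicativity.
Variable A : comUnitRingType.
Local Notation X := (@fps_X A).

Lemma fps_comp_inj (t F G : fps A) : t 0%N = 0 -> t 1%N \is a GRing.unit ->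
  fps_comp F t = fps_comp G t -> F = G.
Proof.
move=> t0 t1 FG; have [s0 ts _] := comp_invP t0 t1.
by rewrite -[F]fps_compX -ts -fps_compA // FG fps_compA // ts fps_compX.
Qed.

(** M1, M2 are to be the even and N1, N2 the odd alternating series.  The four
    equations force R1(z N2) = R2(z N1), the common value t satisfies
    M1 = 1 + t, and all three inverses can be evaluated at t. *)
Lemma comp_inv_mul (R1 R2 R : fps A) (M1 M2 N1 N2 : fps A) :
  is_comp_inv R1 (comp_inv R1) -> is_comp_inv R2 (comp_inv R2) ->
  is_comp_inv R (comp_inv R) ->
  R1 0%N = 0 -> R2 0%N = 0 -> R 0%N = 0 ->
  R1 1%N \is a GRing.unit -> N2 0%N \is a GRing.unit ->
  M1 = 1 + fps_comp R1 (X * N2) -> M2 = 1 + fps_comp R2 (X * N1) ->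
  X * N2 * N1 = fps_comp R1 (X * N2) * M2 ->
  X * N1 * N2 = fps_comp R2 (X * N1) * M1 ->
  M1 = 1 + fps_comp R (X * M1) ->
  X * comp_inv R = comp_inv R1 * comp_inv R2.
Proof.
case=> [_ _ G1R] [_ _ G2R] [_ _ GR] R10 R20 R0 R11 N20 M1E M2E E1 E2 ME.
have X0 F : (X * F) 0%N = 0 by rewrite fps_coef_XM.
set t := fps_comp R1 (X * N2) in M1E E1.
(* R2(z N1) (1 + t) = t (1 + R2(z N1)). *)
have tE : fps_comp R2 (X * N1) = t.
  apply/eqP; rewrite -subr_eq0; apply/eqP.
  have -> : fps_comp R2 (X * N1) - t
    = fps_comp R2 (X * N1) * M1 - t * M2 by rewrite M1E M2E; ring.
  by rewrite -E1 -E2; ring.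
rewrite tE in M2E E2.
have RE : fps_comp R (X * M1) = t.
  by apply: (addrI 1); rewrite -ME.
have t0 : t 0%N = 0 by rewrite /t fps_comp_at0.
have t1 : t 1%N \is a GRing.unit.
  rewrite /t fps_comp_shift // R10 fps_coefD add0r -mulrA fps_coef_XM.
  by rewrite fps_coef0M fps_comp_at0 unitrM N20.
apply: (fps_comp_inj t0 t1); rewrite !fps_compM // fps_Xcomp //.
have e1 : fps_comp (comp_inv R1) t = X * N2.
  by rewrite /t -fps_compA // G1R fps_Xcomp.
have e2 : fps_comp (comp_inv R2) t = X * N1.
  by rewrite -tE -fps_compA // G2R fps_Xcomp.
have e : fps_comp (comp_inv R) t = X * M1.
  by rewrite -RE -fps_compA // GR fps_Xcomp.
rewrite e e1 e2.
by rewrite mulrCA -E2; ring.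
Qed.

End Multiplicativity.

(** * Free pairs *)

Lemma moment_map (T T' : Type) (C : comNzRingType) (f : T -> T')
    (k : seq T' -> C) (w : seq T) :
  moment (fun w => k (map f w)) w = moment k (map f w).
Proof.
have -> : [seq f i | i <- w] = subword (f \o tnth (in_tuple w)) setT.
  rewrite /subword enum_setT -enumT (map_comp f).
  by rewrite (map_tnth_enum (in_tuple w)).
rewrite -ncsum_moment; apply: eq_bigr => g _; apply: eq_bigr => B _.
by rewrite /subword -map_comp.
Qed.

Section WordCumulants.
Variables (K : fieldType) (P : ncps_typeB K).

(** Cumulants as a function of words, so that restriction to a block becomes
    passage to a subword. *)
Definition cumulant (s : seq (prodAX P)) : dual K := kappa (tnth (in_tuple s)).

Lemma kappa_cumulant n (x : 'I_n -> prodAX P) s :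
  size s = n -> (forall y (i : 'I_n), x i = nth y s i) -> kappa x = cumulant s.
Proof.
move=> e xE; rewrite -(kappa_cast (@kappa K P) e); congr kappa.
apply: funext => i; pose z := tnth (in_tuple s) i.
by rewrite (xE z) [RHS](tnth_nth z).
Qed.

Lemma moment_expectB (s : seq (prodAX P)) :
  moment cumulant s = expectB (\prod_(y <- s) y).
Proof.
have [->|s0] := eqVneq s [::].
  rewrite moment_nil big_nil; apply: dualP; rewrite /= ?ncphi1 ?linear0 //.
rewrite (big_tnth _ _ s) -moment_cumulant; last by rewrite lt0n size_eq0.
apply: eq_bigr => g _; apply: eq_bigr => B _; apply/esym/kappa_cumulant.
  by rewrite size_map -cardE.
by move=> y i; rewrite /subword nth_image.
Qed.

Lemma Rtransform_cumulant (y : prodAX P) :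
  Rtransform y = @fps_X (dual K) * cumulant_series cumulant y.
Proof.
apply: funext => -[|n]; rewrite fps_coef_XM //=.
apply: kappa_cumulant; first by rewrite size_nseq.
by move=> z i; rewrite nth_nseq ltn_ord.
Qed.

End WordCumulants.

(** The S-transform is the inverse series shifted by one, so z G = G1 G2 read
    off at degree n + 2 is the claim at degree n: the two outer terms of the
    product vanish with the constant terms. *)
Lemma Stransform_mul_of_comp_inv (K : fieldType) (P : ncps_typeB K)
    (y1 y2 y : prodAX P) :
  ncphi P (fstA y1) != 0 -> ncphi P (fstA y2) != 0 ->
  @fps_X (dual K) * comp_inv (Rtransform y)
    = comp_inv (Rtransform y1) * comp_inv (Rtransform y2) ->
  Stransform y = fps_mul (Stransform y1) (Stransform y2).
Proof.
move=> /Stransform_comp_inv[g1 _ _] /Stransform_comp_inv[g2 _ _] E.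
apply: funext => n; move: (congr1 (fun F : fps (dual K) => F n.+2) E).
rewrite fps_coef_XM /Stransform => ->.
rewrite fps_coefM big_ord_recl g1 mul0r add0r.
rewrite big_ord_recr /= subnn g2 mulr0 addr0.
by apply: eq_bigr => i _; rewrite /bump /= add1n subSS subSn // -ltnS.
Qed.

Section FreePair.
Variables (K : fieldType) (P : ncps_typeB K) (y1 y2 : prodAX P).
Let y (b : bool) := if b then y2 else y1.
Hypothesis mixed : forall w : seq bool,
  true \in w -> false \in w -> cumulant [seq y b | b <- w] = 0.
Hypotheses (phi1 : ncphi P (fstA y1) != 0) (phi2 : ncphi P (fstA y2) != 0).

(** Freeness enters only through the mixed cumulants of the two elements
    themselves. *)
Lemma Stransform_free_mul :
  Stransform (y1 * y2) = fps_mul (Stransform y1) (Stransform y2).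
Proof.
pose k w := cumulant [seq y b | b <- w].
have kE b : @fps_X (dual K) * cumulant_series k b = Rtransform (y b).
  rewrite Rtransform_cumulant; congr (_ * _); apply: funext => n.
  by rewrite /cumulant_series /k map_nseq.
have k1E b : k [:: b] = expectB (y b).
  by rewrite -Rtransform1 -kE fps_coef_XM.
(* The mixed cumulant of length two vanishes, so the moment factors and
   the S-transform of the product makes sense. *)
have EE : expectB (y1 * y2) = expectB y1 * expectB y2.
  have -> : y1 * y2 = \prod_(z <- [seq y b | b <- [:: false; true]]) z.
    by rewrite /= !big_cons big_nil mulr1.
  rewrite -moment_expectB -moment_map -/k !moment_cons /= moment_cons /=.
  rewrite moment_nil !mul1r [k [:: false; true]]mixed // addr0.
  by rewrite !k1E mulrC.
have unitE z : (expectB z \is a GRing.unit) = (ncphi P (fstA z) != 0).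
  by rewrite dual_unitE.
have phi12 : ncphi P (fstA (y1 * y2)) != 0.
  by rewrite -unitE EE unitrM !unitE phi1.
have k_mixed w : true \in w -> false \in w -> k w = 0 by apply: mixed.
have mevenE b : alt_series k false b
   = 1 + fps_comp (Rtransform (y b))
                  (@fps_X (dual K) * alt_series k true (~~ b)).
  by rewrite -kE; apply: alt_series_even.
have multE b : @fps_X (dual K) * alt_series k true (~~ b) * alt_series k true b
   = fps_comp (Rtransform (y b)) (@fps_X (dual K) * alt_series k true (~~ b))
     * alt_series k false (~~ b).
  rewrite [X in _ * X = _](alt_series_odd k_mixed) -kE.
  rewrite fps_compM ?fps_coef_XM //.
  by rewrite fps_Xcomp ?fps_coef_XM // mulrA.
apply: Stransform_mul_of_comp_inv phi1 phi2 _.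
apply: (@comp_inv_mul _ _ _ _
  (alt_series k false false) (alt_series k false true)
  (alt_series k true false) (alt_series k true true)) => //.
- exact: Stransform_comp_inv.
- exact: Stransform_comp_inv.
- exact: Stransform_comp_inv.
- by rewrite Rtransform1 unitE.
- rewrite /alt_series /= moment_cons /= moment_nil mul1r.
  by rewrite k1E unitE.
- exact: (multE false).
- exact: (multE true).
rewrite Rtransform_cumulant; apply: moment_series_eq => n.
rewrite /alt_series (moment_map y) !moment_expectB; congr expectB.
rewrite add0n; elim: n => [|n IH]; first by rewrite !big_nil.
by rewrite /= !big_cons IH mulrA.
Qed.

End FreePair.

Lemma free_cumulant_mixed (K : fieldType) (P : ncps_typeB K)
    (As : 'I_2 -> {pred ncA P}) (Xs : 'I_2 -> {pred ncX P})
    (y1 y2 : prodAX P) (w : seq bool) :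
  free_independent As Xs ->
  fstA y1 \in As ord0 -> sndX y1 \in Xs ord0 ->
  fstA y2 \in As ord_max -> sndX y2 \in Xs ord_max ->
  true \in w -> false \in w ->
  cumulant [seq if b then y2 else y1 | b <- w] = 0.
Proof.
move=> [_ free] a1 x1 a2 x2 tw fw.
pose i (l : 'I_(size w)) : 'I_2 :=
  if tnth (in_tuple w) l then ord_max else ord0.
rewrite -(@kappa_cumulant _ _ (size w)
  (fun l => if tnth (in_tuple w) l then y2 else y1)) ?size_map //; last first.
  by move=> z l; rewrite (nth_map true) // -(tnth_nth true (in_tuple w)).
apply: (free _ i) => [l|]; first by rewrite /i; case: (tnth _ _).
have [s ws] : exists s, tnth (in_tuple w) s = true.
  by have /tnthP[s ->] : true \in in_tuple w; [|exists s].
have [t wt] : exists t, tnth (in_tuple w) t = false.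
  by have /tnthP[t ->] : false \in in_tuple w; [|exists t].
case: (ltngtP s t) => [st|ts|/val_inj est].
- by exists s, t; split=> //; rewrite /i ws wt.
- by exists t, s; split=> //; rewrite /i ws wt.
- by move: wt; rewrite -est ws.
Qed.

Theorem theorem4p2 (R : realType) (P : ncps_typeB R[i])
    (As : 'I_2 -> {pred ncA P}) (Xs : 'I_2 -> {pred ncX P})
    (indep : free_independent As Xs)
    (a : 'I_2 -> ncA P) (xi : 'I_2 -> ncX P)
    (a_in : forall j, a j \in As j) (xi_in : forall j, xi j \in Xs j)
    (phi_neq0 : forall j, ncphi P (a j) != 0) :
  let x1 := ProdAX (a ord0) (xi ord0) in
  let x2 := ProdAX (a ord_max) (xi ord_max) in
  Stransform (x1 * x2) = fps_mul (Stransform x1) (Stransform x2).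
Proof.
move=> x1 x2; apply: Stransform_free_mul => [w||].
- by apply: (free_cumulant_mixed indep);
    [exact: a_in|exact: xi_in|exact: a_in|exact: xi_in].
- exact: phi_neq0.
- exact: phi_neq0.
Qed.
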